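(* Let $f,g:\mathbb{R}^n\to(-\infty,+\infty]$ be proper, lower semicontinuous and prox-bounded with thresholds $\lambda_f,\lambda_g>0$, let $\bar\lambda=\min\{\lambda_f,\lambda_g\}$, $0<\mu<\bar\lambda$, $\alpha\in[0,1]$, and let $\varphi^{\alpha}_{\mu}=-e_{\mu}(-\alpha e_{\mu}f-(1-\alpha)e_{\mu}g)$. Then the following hold. (a) The Moreau envelope $e_{\mu}(\varphi^{\alpha}_{\mu})=\alpha e_{\mu}f+(1-\alpha)e_{\mu}g$. (b) $\varphi^{\alpha}_{\mu}$ is proper, lower semicontinuous and prox-bounded with threshold $\lambda_{\varphi^{\alpha}_{\mu}}\ge\bar\lambda$. (c) $$\varphi^{\alpha}_{\mu}(x)=\left[\alpha\operatorname{conv}\Big(f+\tfrac{1}{2\mu}\|\cdot\|^2\Big)\Big(\tfrac{\cdot}{\alpha}\Big)\,\Box\,(1-\alpha)\operatorname{conv}\Big(g+\tfrac{1}{2\mu}\|\cdot\|^2\Big)\Big(\tfrac{\cdot}{1-\alpha}\Big)\right](x)-\frac{1}{2\mu}\|x\|^2,$$ where the infimal convolution $\Box$ is exact; consequently $$\operatorname{epi}\Big(\varphi^{\alpha}_{\mu}+\tfrac{1}{2\mu}\|\cdot\|^2\Big)=\alpha\operatorname{epi}\operatorname{conv}\Big(f+\tfrac{1}{2\mu}\|\cdot\|^2\Big)+(1-\alpha)\operatorname{epi}\operatorname{conv}\Big(g+\tfrac{1}{2\mu}\|\cdot\|^2\Big).$$ (d) $\operatorname{dom}\varphi^{\alpha}_{\mu}=\alpha\operatorname{conv}\operatorname{dom}f+(1-\alpha)\operatorname{conv}\operatorname{dom}g$.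 In particular, $\operatorname{dom}\varphi^{\alpha}_{\mu}=\mathbb{R}^n$ if either one of $\operatorname{conv}\operatorname{dom}f$ and $\operatorname{conv}\operatorname{dom}g$ is $\mathbb{R}^n$. (e) The proximal average of $f$ and $g$ is the same as the proximal average of the proximal hulls $h_{\mu}f$ and $h_{\mu}g$, respectively. (f) When $\alpha=0$, $\varphi^{0}_{\mu}=h_{\mu}g$; when $\alpha=1$, $\varphi^{1}_{\mu}=h_{\mu}f$. (g) Each $\varphi^{\alpha}_{\mu}$ is $\mu$-proximal, or equivalently, $\mu$-hypoconvex. (h) When $f=g$, $\varphi^{\alpha}_{\mu}=h_{\mu}f$; consequently, $\varphi^{\alpha}_{\mu}=f$ when $f=g$ is $\mu$-proximal. (i) When $g\equiv c\in\mathbb{R}$, $\varphi^{\alpha}_{\mu}=e_{\mu/\alpha,\mu}(\alpha f+(1-\alpha)c)$, the Lasry--Lions envelope of $\alpha f+(1-\alpha)c$.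
   Context: $\|\cdot\|$ is the Euclidean norm. For a proper function $f$ and $\lambda>0$: the Moreau envelope is $e_{\lambda}f(x)=\inf_{w}\{f(w)+\frac{1}{2\lambda}\|w-x\|^2\}$; the proximal hull is $h_{\lambda}f(x)=\sup_{w}\{e_{\lambda}f(w)-\frac{1}{2\lambda}\|x-w\|^2\}=-e_{\lambda}(-e_{\lambda}f)(x)$; for $0<\mu<\lambda$ the Lasry--Lions envelope is $e_{\lambda,\mu}f(x)=\sup_{w}\{e_{\lambda}f(w)-\frac{1}{2\mu}\|x-w\|^2\}$. $f$ is prox-bounded if there exist $\lambda>0$ and $x$ with $e_{\lambda}f(x)>-\infty$; the supremum of all such $\lambda$ is its threshold $\lambda_f\in(0,+\infty]$. The function $\varphi^{\alpha}_{\mu}$ is called the proximal average of $f,g$ associated with parameters $\mu,\alpha$. $f$ is $\mu$-proximal if $f+\frac{1}{2\mu}\|\cdot\|^2$ is convex; $f$ is $\mu$-hypoconvex if $f((1-t)x+ty)\le(1-t)f(x)+tf(y)+\frac{1}{2\mu}t(1-t)\|x-y\|^2$ for all $x,y\in\mathbb{R}^n$, $t\in(0,1)$. $\operatorname{conv}$ denotes the convex hull of a function (the largest convex function below it) or of a set, $\operatorname{epi}h$ the epigraph and $\operatorname{dom}h$ the effective domain of $h$. $\alpha h(\frac{\cdot}{\alpha})$ denotes $x\mapsto\alpha h(x/\alpha)$. The infimal convolution is $f_1\Box f_2(x)=\inf_{w}\{f_1(x-w)+f_2(w)\}$; it is exact if the infimum is attained at every point of its domain. Sums of sets are Minkowski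 sums.
   Formalization: In the second sentence of (d), α≠0 is required when conv dom f=ℝⁿ is the one assumed and α≠1 when it is conv dom g, since at the endpoints the claim fails (α=0, f=0, g the indicator of {0}); at α=0 (α=1), the scaled function in (c) is the indicator of {0}, and (i) has zero penalty at α=0. *)

(* Defs.v *)
From HB Require Import structures.
From mathcomp Require Import all_boot all_order all_algebra.
From mathcomp Require Import all_classical all_reals all_analysis.

Set Implicit Arguments.
Unset Strict Implicit.
Unset Printing Implicit Defensive.

Import Order.TTheory GRing.Theory Num.Theory.
Import numFieldNormedType.Exports.

Local Open Scope classical_set_scope.
Local Open Scope ring_scope.
Local Open Scope ereal_scope.

(* The topology on 'rV[R]_n is the library's; its norm `|x| is the sup norm,
   hence the separate Euclidean norm. *)
Definition enorm (R : realType) (n : nat) (x : 'rV[R]_n) : R :=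
  Num.sqrt (\sum_(i < n) x ord0 i ^+ 2)%R.

Definition quad (R : realType) (n : nat) (mu : R) (x : 'rV[R]_n) : R :=
  ((2 * mu)^-1 * enorm x ^+ 2)%R.

Definition set_scale (R : realType) (V : lmodType R) (a : R) (A : set V) :
  set V := [set (a *: x)%R | x in A].

Definition set_add (R : realType) (V : lmodType R) (A B : set V) : set V :=
  [set (x + y)%R | x in A & y in B].

Definition conv_set (R : realType) (V : lmodType R) (A : set V) : set V :=
  smallest (@convex_set R V) A.

Definition dom (R : realType) (n : nat) (h : 'rV[R]_n -> \bar R) :
  set 'rV[R]_n := [set x | h x < +oo].

Definition proper_fun (R : realType) (n : nat) (h : 'rV[R]_n -> \bar R) : Prop :=
  (forall x, -oo < h x) /\ dom h !=set0.

(* R^o is R as a module over itself, so that epigraphs live in a module. *)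
Definition epi (R : realType) (n : nat) (h : 'rV[R]_n -> \bar R) :
  set ('rV[R]_n * R^o)%type := [set p | h p.1 <= (p.2 : R)%:E].

(* Convexity through the epigraph makes sense even if both infinities are
   values of h, where the usual inequality would involve +oo - oo. *)
Definition convex_fun (R : realType) (n : nat) (h : 'rV[R]_n -> \bar R) :
  Prop := @convex_set R ('rV[R]_n * R^o)%type (epi h).

(* The pointwise supremum of the convex minorants of h; by the three lemmas
   conv_fun_convex, conv_fun_le and conv_fun_max it is the largest of them. *)
Definition conv_fun (R : realType) (n : nat) (h : 'rV[R]_n -> \bar R)
    (x : 'rV[R]_n) : \bar R :=
  ereal_sup [set k x | k in [set k : 'rV[R]_n -> \bar R |
                             convex_fun k /\ forall y, k y <= h y]].

Definition add_quad (R : realType) (n : nat) (mu : R)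
    (h : 'rV[R]_n -> \bar R) (x : 'rV[R]_n) : \bar R :=
  h x + (quad mu x)%:E.

(* a h(./a), with the usual convention that it is the indicator function
   of {0} if a = 0. *)
Definition epi_scale (R : realType) (n : nat) (a : R)
    (h : 'rV[R]_n -> \bar R) (x : 'rV[R]_n) : \bar R :=
  if a == 0%R then (if x == 0%R then 0 else +oo)
  else a%:E * h (a^-1 *: x)%R.

Definition infconv (R : realType) (n : nat) (h k : 'rV[R]_n -> \bar R)
    (x : 'rV[R]_n) : \bar R :=
  ereal_inf [set h (x - w)%R + k w | w in [set: 'rV[R]_n]].

Definition infconv_exact (R : realType) (n : nat)
    (h k : 'rV[R]_n -> \bar R) : Prop :=
  forall x, dom (infconv h k) x ->
    exists w, h (x - w)%R + k w = infconv h k x.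

Definition mu_proximal (R : realType) (n : nat) (mu : R)
    (h : 'rV[R]_n -> \bar R) : Prop := convex_fun (add_quad mu h).

Definition mu_hypoconvex (R : realType) (n : nat) (mu : R)
    (h : 'rV[R]_n -> \bar R) : Prop :=
  forall (x y : 'rV[R]_n) (t : R), (0 < t < 1)%R ->
    h ((1 - t) *: x + t *: y)%R <=
    (1 - t)%:E * h x + t%:E * h y
      + ((2 * mu)^-1 * t * (1 - t) * enorm (x - y) ^+ 2)%:E.

Definition moreau (R : realType) (n : nat) (lambda : R)
    (h : 'rV[R]_n -> \bar R) (x : 'rV[R]_n) : \bar R :=
  ereal_inf [set h w + (quad lambda (w - x))%:E | w in [set: 'rV[R]_n]].

Definition lasry_lions (R : realType) (n : nat) (lambda mu : R)
    (h : 'rV[R]_n -> \bar R) (x : 'rV[R]_n) : \bar R :=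
  ereal_sup
    [set moreau lambda h w - (quad mu (x - w))%:E | w in [set: 'rV[R]_n]].

Definition prox_hull (R : realType) (n : nat) (lambda : R)
    (h : 'rV[R]_n -> \bar R) (x : 'rV[R]_n) : \bar R :=
  ereal_sup
    [set moreau lambda h w - (quad lambda (x - w))%:E | w in [set: 'rV[R]_n]].

Definition prox_parameters (R : realType) (n : nat)
    (h : 'rV[R]_n -> \bar R) : set R :=
  [set lambda | (0 < lambda)%R /\ exists x, -oo < moreau lambda h x].

Definition prox_bounded (R : realType) (n : nat)
    (h : 'rV[R]_n -> \bar R) : Prop := prox_parameters h !=set0.

Definition prox_threshold (R : realType) (n : nat)
    (h : 'rV[R]_n -> \bar R) : \bar R :=
  ereal_sup [set lambda%:E | lambda in prox_parameters h].

Definition prox_average (R : realType) (n : nat) (mu alpha : R)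
    (f g : 'rV[R]_n -> \bar R) (x : 'rV[R]_n) : \bar R :=
  - moreau mu (fun y => - (alpha%:E * moreau mu f y)
                        - (1 - alpha)%:E * moreau mu g y) x.

Lemma conv_fun_le (R : realType) (n : nat) (h : 'rV[R]_n -> \bar R) x :
  conv_fun h x <= h x.
Proof. by apply: ge_ereal_sup => _ [k [_ kh] <-]; exact: kh. Qed.

Lemma conv_fun_max (R : realType) (n : nat) (h k : 'rV[R]_n -> \bar R) :
  convex_fun k -> (forall y, k y <= h y) -> forall x, k x <= conv_fun h x.
Proof. by move=> ck kh x; apply: ereal_sup_ubound; exists k. Qed.

Lemma conv_fun_convex (R : realType) (n : nat) (h : 'rV[R]_n -> \bar R) :
  convex_fun (conv_fun h).
Proof.
move=> p q t; rewrite !inE /epi /= => hp hq.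
apply: ge_ereal_sup => _ [k [ck kh] <-].
have : p \in epi k by rewrite inE; exact: le_trans (conv_fun_max ck kh _) hp.
have : q \in epi k by rewrite inE; exact: le_trans (conv_fun_max ck kh _) hq.
by move=> qk pk; have := ck p q t pk qk; rewrite inE.
Qed.

Lemma prox_hullE (R : realType) (n : nat) (lambda : R)
    (h : 'rV[R]_n -> \bar R) x :
  prox_hull lambda h x = - moreau lambda (fun y => - moreau lambda h y) x.
Proof.
rewrite /prox_hull [in RHS]/moreau /ereal_inf oppeK; congr ereal_sup.
have quadC w : quad lambda (x - w)%R = quad lambda (w - x)%R.
  by rewrite /quad /enorm; congr (_ * Num.sqrt _ ^+ 2)%R;
     apply: eq_bigr => i _; rewrite !mxE -[in RHS]opprB sqrrN.
apply/seteqP; split=> [_ [w _ <-]|_ [_ [w _ <-] <-]] /=.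
  exists (- moreau lambda h w + (quad lambda (w - x))%:E).
    by exists w.
  by rewrite oppeD ?oppeK ?quadC // fin_num_adde_defl.
by exists w => //; rewrite oppeD ?oppeK ?quadC // fin_num_adde_defl.
Qed.

(* Main.v *)
(* Write q = |.|^2 / (2 mu), F = conv (f + q) and G = conv (g + q). Expanding
   |w - u|^2 gives e_mu h(w) = q(w) - (h + q)^*(w / mu), so the envelope sees
   h + q only through its conjugate, hence only through its convex hull, and
   (phi + q)^* = alpha F^* + (1 - alpha) G^*. The right-hand side is the
   conjugate of the infimal convolution Phi of alpha F(./alpha) and
   (1 - alpha) G(./(1 - alpha)), and phi + q is a conjugate; so everything
   follows from Phi = Phi^**, i.e. from Phi being convex and lower
   semicontinuous.
   Since mu is below the thresholds, f + q and g + q dominate c + a |.|^2 with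
   a > 0. Under such a bound the perspective (t, y) |-> t h(y / t), extended by
   the indicator of {0} at t = 0, is jointly lower semicontinuous. By
   Caratheodory's theorem conv h is a partial infimum of finitely many
   perspectives over a compact set of parameters, so it is lower
   semicontinuous, and the same argument applies to Phi. *)
Require Import Defs.
From HB Require Import structures.
From mathcomp Require Import all_boot all_order all_algebra.
From mathcomp Require Import all_classical all_reals all_analysis.
From mathcomp Require Import ring lra.

Set Implicit Arguments.
Unset Strict Implicit.
Unset Printing Implicit Defensive.

Import Order.TTheory GRing.Theory Num.Theory.
Import numFieldNormedType.Exports.

Local Open Scope classical_set_scope.
Local Open Scope ring_scope.
Local Open Scope ereal_scope.

(** * Lower semicontinuity *)

(** Convex hulls and infimal convolutions do not preserve lower semicontinuity in general, because
    their infima run over non-compact parameter sets. The strict inequality between mu and the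
    thresholds is spent on a lambda strictly between them: a = 1/(2 mu) - 1/(2 lambda) is then
    positive, and it survives every construction, since c + a |.|^2 is itself a convex minorant. It
    also gives back the threshold of phi, as phi + q >= c + a |.|^2 reads phi >= c - |.|^2/(2
    lambda). Biconjugation is used in an elementary form: for every real r < Phi(x) there is an
    affine minorant of Phi with value r at x. It comes from minimizing Phi plus a steep quadratic,
    so coercivity takes the place of a separation theorem. Sums of opposite infinities are avoided
    by comparing with real numbers throughout. The weights 0 and 1 need no separate main argument,
    because the indicator of {0} is the lower semicontinuous extension of the perspective to t = 0
    under quadratic growth. *)

Lemma lty_le_fin (R : realType) (x : \bar R) :
  x < +oo -> exists r : R, x <= r%:E.
Proof.
by case: x => [r _| |] //; [exists r|exists 0%R; exact: leNye].
Qed.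

Lemma lte_fin_split (R : realType) (a : R) (x y : \bar R) :
  -oo < x -> -oo < y -> a%:E < x + y ->
  exists b c : R, [/\ b%:E < x, c%:E < y & (a <= b + c)%R].
Proof.
case: x => [r| |] //; case: y => [s| |] // _ _.
- rewrite -EFinD lte_fin => ars.
  by exists (r - (r + s - a) / 2)%R, (s - (r + s - a) / 2)%R; split;
    rewrite ?lte_fin; lra.
- move=> _; exists (r - 1)%R, (a - r + 1)%R.
  by split; rewrite ?ltry ?lte_fin //; lra.
- move=> _; exists (a - s + 1)%R, (s - 1)%R.
  by split; rewrite ?ltry ?lte_fin //; lra.
- by move=> _; exists a, 0%R; split; rewrite ?ltry // addr0.
Qed.

Lemma lte_fin_between (R : realType) (a : R) (y : \bar R) :
  a%:E < y -> exists2 b : R, (a < b)%R & b%:E < y.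
Proof.
case: y => [r| |] //.
  by rewrite lte_fin => ar; exists ((a + r) / 2)%R; rewrite ?lte_fin; lra.
by move=> _; exists (a + 1)%R; rewrite ?ltry //; lra.
Qed.

Lemma lsc_add (R : realType) (T : topologicalType) (f g : T -> \bar R) :
  (forall x, -oo < f x) -> (forall x, -oo < g x) ->
  lower_semicontinuous f -> lower_semicontinuous g ->
  lower_semicontinuous (fun x => f x + g x).
Proof.
move=> f_gt g_gt fl gl x a /(lte_fin_split (f_gt x) (g_gt x)).
move=> [b [c [/fl[U xU fU] /gl[V xV gV] abc]]].
exists (U `&` V); first exact: filterI.
move=> y [/fU fy /gV gy]; rewrite (@le_lt_trans _ _ (b%:E + c%:E)) //.
exact: lteD.
Qed.

Lemma lsc_comp (R : realType) (S T : topologicalType) (f : T -> \bar R)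
    (k : S -> T) :
  continuous k -> lower_semicontinuous f ->
  lower_semicontinuous (fun x => f (k x)).
Proof.
move=> ck fl x a /fl[V kxV fV]; exists (k @^-1` V); first exact: ck.
by move=> y /fV.
Qed.

Lemma lsc_EFin (R : realType) (T : topologicalType) (k : T -> R) :
  continuous k -> lower_semicontinuous (fun x => (k x)%:E).
Proof.
move=> ck x a; rewrite lte_fin => akx; exists (k @^-1` [set r | (a < r)%R]).
  by apply: ck; exact: lt_nbhsr.
by move=> y /=; rewrite lte_fin.
Qed.

(** The sublevel sets within [K] are nested, hence form a filter base. At a cluster point x that is
    not a minimizer, lower semicontinuity keeps [f] above a level that some sublevel set does not
    exceed. *)
Lemma lsc_attains_min (R : realType) (T : topologicalType) (f : T -> \bar R)
    (K : set T) :
  lower_semicontinuous f -> compact K -> K !=set0 ->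
  exists2 x, K x & forall y, K y -> f x <= f y.
Proof.
move=> fl cK [z Kz]; apply: contrapT => noMin.
have {noMin} noMin x : K x -> exists2 y, K y & f y < f x.
  move=> Kx; apply: contrapT => xmin; apply: noMin; exists x => // y Ky.
  by rewrite leNgt; apply/negP => yx; apply: xmin; exists y.
pose B (y : T) := [set x | K x /\ f x <= f y].
pose G := filter_from K B.
have GF : ProperFilter G.
  apply: filter_from_proper; last by move=> y Ky; exists y; split.
  apply: filter_from_filter; first by exists z.
  move=> x y Kx Ky; have [xy|/ltW yx] := leP (f x) (f y).
    by exists x => // u [Ku ux]; split; split => //; exact: le_trans xy.
  by exists y => // u [Ku uy]; split; split => //; exact: le_trans yx.
have [|x [Kx clx]] := cK G GF; first by exists z => // u [].
(* Two descents, so that f y lies strictly between two values and is therefore a real level. *)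
have [y Ky yx] := noMin x Kx; have [w Kw wy] := noMin y Ky.
have [a wa ay] : exists2 a : R, f w <= a%:E & a%:E < f x.
  case: (f y) wy yx => [r| |] //.
    by move=> /ltW wr rx; exists r.
  by move=> _; rewrite ltNge leey.
  by rewrite ltNge leNye.
have [V xV fV] := fl _ _ ay.
have [u [[Ku uw] Vu]] : B w `&` V !=set0 by apply: clx => //; exists w.
by have := fV _ Vu; rewrite ltNge (le_trans uw).
Qed.

(* The tube lemma gives lower semicontinuity once the relevant part of the
   parameter space is compact locally uniformly in x. *)
Lemma lsc_ereal_inf (R : realType) (T U : topologicalType)
    (f : T * U -> \bar R) :
  lower_semicontinuous f ->
  (forall (x : T) (r : R), exists (V : set T) (K : set U), [/\ nbhs x V, compact K &
     forall y u, V y -> f (y, u) <= r%:E -> K u]) ->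
  lower_semicontinuous (fun x => ereal_inf [set f (x, u) | u in [set: U]]).
Proof.
(* Values above [b] only bound the infimum below by [b]; the gap a < b restores strictness. *)
move=> fl fK x a /lte_fin_between[b ab bx].
have [V [K [xV cK VK]]] := fK x b.
have /compact_near_coveringP/(_ T (nbhs x) (fun y u => b%:E < f (y, u))) := cK.
have cov : forall u, K u ->
    \forall u' \near u & y \near nbhs x, b%:E < f (y, u').
  move=> u Ku; have : b%:E < f (x, u).
    by apply: lt_le_trans bx _; apply: ereal_inf_lbound; exists u.
  move=> /fl[W [[W1 W2] /= [xW1 uW2] W12W] fW]; exists (W2, W1) => //=.
  by move=> [u' y] /= [W2u' W1y]; apply: fW; apply: W12W.
move=> /(_ _ cov); case: (nbhs_filter x) => _ _ _ /= xK.
exists (V `&` [set y | K `<=` (fun u => b%:E < f (y, u))]).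
  exact: filterI.
move=> y [Vy Ky]; apply: (@lt_le_trans _ _ b%:E); first by rewrite lte_fin.
apply: le_ereal_inf_tmp => _ [u _ <-].
rewrite leNgt; apply/negP => /[dup] /ltW/(VK _ _ Vy)/Ky /lt_trans h /h.
by rewrite ltxx.
Qed.

(** * The Euclidean inner product and perspectives *)

Definition dot (R : realType) (n : nat) (u v : 'rV[R]_n) : R :=
  (\sum_(i < n) u ord0 i * v ord0 i)%R.

Lemma dotC (R : realType) (n : nat) (u v : 'rV[R]_n) : dot u v = dot v u.
Proof. by apply: eq_bigr => i _; rewrite mulrC. Qed.

Lemma dotDl (R : realType) (n : nat) (u v w : 'rV[R]_n) :
  dot (u + v)%R w = (dot u w + dot v w)%R.
Proof. by rewrite -big_split; apply: eq_bigr => i _; rewrite mxE mulrDl. Qed.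

Lemma dotZl (R : realType) (n : nat) (a : R) (u w : 'rV[R]_n) :
  dot (a *: u)%R w = (a * dot u w)%R.
Proof. by rewrite mulr_sumr; apply: eq_bigr => i _; rewrite mxE mulrA. Qed.

Lemma dotNl (R : realType) (n : nat) (u w : 'rV[R]_n) :
  dot (- u)%R w = (- dot u w)%R.
Proof. by rewrite -scaleN1r dotZl mulN1r. Qed.

Lemma dotBl (R : realType) (n : nat) (u v w : 'rV[R]_n) :
  dot (u - v)%R w = (dot u w - dot v w)%R.
Proof. by rewrite dotDl dotNl. Qed.

Lemma dotDr (R : realType) (n : nat) (u v w : 'rV[R]_n) :
  dot w (u + v)%R = (dot w u + dot w v)%R.
Proof. by rewrite dotC dotDl !(dotC w). Qed.

Lemma dotZr (R : realType) (n : nat) (a : R) (u w : 'rV[R]_n) :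
  dot w (a *: u)%R = (a * dot w u)%R.
Proof. by rewrite dotC dotZl (dotC w). Qed.

Lemma dotNr (R : realType) (n : nat) (u w : 'rV[R]_n) :
  dot w (- u)%R = (- dot w u)%R.
Proof. by rewrite dotC dotNl (dotC w). Qed.

Lemma dotBr (R : realType) (n : nat) (u v w : 'rV[R]_n) :
  dot w (u - v)%R = (dot w u - dot w v)%R.
Proof. by rewrite dotC dotBl !(dotC w). Qed.

Lemma dot0l (R : realType) (n : nat) (w : 'rV[R]_n) : dot 0%R w = 0%R.
Proof. by apply: big1 => i _; rewrite mxE mul0r. Qed.

Lemma dot_ge0 (R : realType) (n : nat) (u : 'rV[R]_n) : (0 <= dot u u)%R.
Proof. by apply: sumr_ge0 => i _; rewrite -expr2 sqr_ge0. Qed.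

Lemma sqr_coord_le_dot (R : realType) (n : nat) (u : 'rV[R]_n) (i : 'I_n) :
  (u ord0 i ^+ 2 <= dot u u)%R.
Proof.
rewrite /dot (bigD1 i) //= -expr2 lerDl.
by apply: sumr_ge0 => j _; rewrite -expr2 sqr_ge0.
Qed.

Lemma dot_gt0 (R : realType) (n : nat) (u : 'rV[R]_n) :
  u != 0%R -> (0 < dot u u)%R.
Proof.
move=> u0; rewrite lt0r dot_ge0 andbT; apply: contra u0 => /eqP u0.
apply/eqP/rowP => i; rewrite mxE; apply/eqP.
by rewrite -sqrf_eq0 eq_le sqr_ge0 -u0 sqr_coord_le_dot.
Qed.

(** The exact convexity defect of |.|^2; it gives both [quad_convex] and the equivalence of
    [mu_proximal] with [mu_hypoconvex]. *)
Lemma dot_convex (R : realType) (n : nat) (t : R) (u v : 'rV[R]_n) :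
  (t * dot u u + (1 - t) * dot v v
     - dot (t *: u + (1 - t) *: v)%R (t *: u + (1 - t) *: v)%R =
   t * (1 - t) * dot (u - v)%R (u - v)%R)%R.
Proof.
rewrite !(dotDl, dotZl, dotNl) !(dotDr, dotZr, dotNr) (dotC v u).
ring.
Qed.

Lemma enorm_sqr (R : realType) (n : nat) (x : 'rV[R]_n) :
  (enorm x ^+ 2 = dot x x)%R.
Proof.
rewrite /enorm sqr_sqrtr; last by apply: sumr_ge0 => i _; rewrite sqr_ge0.
by apply: eq_bigr => i _; rewrite expr2.
Qed.

Lemma quadE (R : realType) (n : nat) (mu : R) (x : 'rV[R]_n) :
  quad mu x = ((2 * mu)^-1 * dot x x)%R.
Proof. by rewrite /quad enorm_sqr. Qed.

Lemma dot_self_continuous (R : realType) (n : nat) :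
  continuous (fun x : 'rV[R]_n => dot x x).
Proof.
rewrite /dot; apply: continuous_big => [|i _ x]; first exact: add_continuous.
by apply: continuousM; exact: (@coord_continuous R 1 n ord0 i).
Qed.

Lemma compact_dot_le (R : realType) (n : nat) (c : R) :
  exists2 K : set 'rV[R]_n, compact K & forall u, (dot u u <= c)%R -> K u.
Proof.
(* Since b >= 1, c <= b <= b^2 bounds every coordinate by [b] without a square root. *)
pose b := (`|c| + 1)%R.
exists [set v : 'rV[R]_n | forall i, [set` `[(- b)%R, b]] (v ord0 i)].
  apply: (@rV_compact R n (fun=> [set` `[(- b)%R, b]])) => _.
  exact: segment_compact.
move=> u uc i; rewrite /= in_itv /= -ler_norml.
have b1 : (1 <= b)%R by rewrite lerDr.
rewrite -(@ler_pXn2r _ 2) ?nnegrE ?real_normK ?num_real //; last exact: le_trans b1.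
apply: le_trans (sqr_coord_le_dot u i) _; apply: le_trans uc _.
apply: le_trans (ler_norm c) _.
by rewrite (@le_trans _ _ b) ?lerDl // expr2 ler_peMl // (le_trans _ b1).
Qed.

Lemma near_gt (R : realType) (T : topologicalType) (k : T -> R) (a : R) x :
  {for x, continuous k} -> (a < k x)%R -> \forall y \near x, (a < k y)%R.
Proof. by move=> ck ak; apply: (ck [set r | (a < r)%R]); exact: lt_nbhsr. Qed.

Lemma near_lt (R : realType) (T : topologicalType) (k : T -> R) (a : R) x :
  {for x, continuous k} -> (k x < a)%R -> \forall y \near x, (k y < a)%R.
Proof. by move=> ck ak; apply: (ck [set r | (r < a)%R]); exact: lt_nbhsl. Qed.

Lemma prod_fst_continuous (S T : topologicalType) :
  continuous (fun p : S * T => p.1).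
Proof. by move=> p; exact: cvg_fst. Qed.

Lemma prod_snd_continuous (S T : topologicalType) :
  continuous (fun p : S * T => p.2).
Proof. by move=> p; exact: cvg_snd. Qed.

Lemma pair_continuous (S T U : topologicalType) (f : S -> T) (g : S -> U) :
  continuous f -> continuous g -> continuous (fun x => (f x, g x)).
Proof. by move=> cf cg x; exact: cvg_pair (cf x) (cg x). Qed.

Definition quad_minorized (R : realType) (n : nat) (c a : R)
    (h : 'rV[R]_n -> \bar R) : Prop :=
  forall u, (c + a * dot u u)%:E <= h u.

(* The value +oo for t < 0 makes persp h lower semicontinuous on the whole
   of R * 'rV[R]_n. *)
Definition persp (R : realType) (n : nat) (h : 'rV[R]_n -> \bar R)
    (p : R * 'rV[R]_n) : \bar R :=
  if (p.1 < 0)%R then +oo else epi_scale p.1 h p.2.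

Lemma perspE (R : realType) (n : nat) (h : 'rV[R]_n -> \bar R) t y :
  (0 <= t)%R -> persp h (t, y) = epi_scale t h y.
Proof. by move=> t0; rewrite /persp /= ltNge t0. Qed.

Lemma lte_mul_fin (R : realType) (r t : R) (x : \bar R) :
  (0 < t)%R -> (r%:E < t%:E * x) = ((r / t)%:E < x).
Proof.
move=> t0; rewrite -[RHS](@lte_pmul2l _ t%:E) ?lte_fin //.
by rewrite -EFinM mulrC divfK // gt_eqF.
Qed.

(** The critical points are those with t = 0, where t h(y/t) >= c t + a |y|^2/t decides: near (0, 0)
    this is at least c t, which tends to 0, and near (0, y0) with y0 nonzero it tends to +oo. With
    linear growth, as for a norm, the limit at (0, y0) would be finite. *)
Lemma persp_lsc (R : realType) (n : nat) (c a : R) (h : 'rV[R]_n -> \bar R) :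
  (0 < a)%R -> quad_minorized c a h -> lower_semicontinuous h ->
  lower_semicontinuous (persp h).
Proof.
move=> a0 hq hl [t0 y0] r rlt.
suff H : \forall p \near (t0, y0), r%:E < persp h p.
  by exists [set p | r%:E < persp h p].
have c1 := @prod_fst_continuous R 'rV[R]_n.
have c2 := @prod_snd_continuous R 'rV[R]_n.
have [t00|t00|t00] := ltgtP t0 0%R.
- have : \forall p \near (t0, y0), (p.1 < 0)%R by apply: near_lt; [exact: c1|].
  by apply: filterS => -[t y] /= t_lt0; rewrite /persp /= t_lt0 ltry.
- move: rlt; rewrite perspE ?(ltW t00) // /epi_scale gt_eqF // lte_mul_fin //.
  (* The intermediate [s] splits the claim into r < t s and s < h(y/t), each valid in a
     neighbourhood. *)
  move=> /lte_fin_between[s rs sh].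
  have cs : {for (t0, y0), continuous (fun p : R * 'rV[R]_n => p.1^-1 *: p.2)%R}.
    apply: cvgZ; last exact: c2.
    by apply: cvgV; [rewrite /= gt_eqF|exact: c1].
  have [V hV Vs] := hl _ _ sh.
  have near_pos : \forall p \near (t0, y0), (0 < p.1)%R.
    by apply: near_gt; [exact: c1|].
  have near_r : \forall p \near (t0, y0), (r < p.1 * s)%R.
    apply: near_gt; last by rewrite /= mulrC -ltr_pdivrMr.
    by apply: cvgM; [exact: c1|exact: cvg_cst].
  have near_h := cs _ hV.
  apply: filterS3 near_pos near_r near_h => -[t y] /= tp tr th.
  rewrite perspE ?(ltW tp) // /epi_scale gt_eqF // lte_mul_fin //.
  by apply: lt_trans (Vs _ th); rewrite lte_fin ltr_pdivrMr // mulrC.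
- subst t0; have [y00|y00] := eqVneq y0 0%R.
    move: rlt; rewrite y00 perspE // /epi_scale !eqxx lte_fin => r0.
    have near_r : \forall p \near (0%R : R, 0%R : 'rV[R]_n), (r < p.1 * c)%R.
      apply: near_gt; last by rewrite /= mul0r.
      by apply: cvgM; [exact: c1|exact: cvg_cst].
    apply: filterS near_r => -[t y] /= tr.
    have [t0|t0|t0] := ltgtP t 0%R.
    + by rewrite /persp /= t0 ltry.
    + rewrite perspE ?(ltW t0) // /epi_scale gt_eqF // lte_mul_fin //.
      apply: lt_le_trans (hq _); rewrite lte_fin ltr_pdivrMr //.
      rewrite (lt_le_trans tr) // mulrC ler_pM2r // lerDl.
      by rewrite mulr_ge0 ?dot_ge0 // ltW.
    + subst t; rewrite perspE // /epi_scale eqxx; case: eqP => _; last exact: ltry.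
      exact: r0.
  pose D := dot y0 y0.
  have D0 : (0 < D)%R by exact: dot_gt0.
  have near_D : \forall p \near (0%R : R, y0), (D / 2 < dot p.2 p.2)%R.
    apply: (@near_gt _ _ (fun p : R * 'rV[R]_n => dot p.2 p.2)).
      apply: (@continuous_comp _ _ _ snd (fun x => dot x x)); first exact: c2.
      exact: dot_self_continuous.
    by rewrite /= -/D; lra.
  (* This is r < c t + a |y|^2/t multiplied by t, with |y|^2 replaced by its lower bound D/2; in
     this form it is continuous at t = 0, where the left side vanishes. *)
  have near_t : \forall p \near (0%R : R, y0),
      (p.1 * r - p.1 * p.1 * c < a * (D / 2))%R.
    apply: near_lt; last by rewrite /= !mul0r subr0; apply: mulr_gt0 => //; lra.
    apply: cvgB; apply: cvgM; try exact: cvg_cst; try exact: c1.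
    by apply: cvgM; exact: c1.
  apply: filterS2 near_D near_t => -[t y] /= yD tr.
  have [t0|t0|t0] := ltgtP t 0%R.
  + by rewrite /persp /= t0 ltry.
  + rewrite perspE ?(ltW t0) // /epi_scale gt_eqF // lte_mul_fin //.
    apply: lt_le_trans (hq _); rewrite lte_fin dotZl dotZr ltr_pdivrMr //.
    have -> : ((c + a * (t^-1 * (t^-1 * dot y y))) * t = 
               (t * t * c + a * dot y y) / t)%R.
      by field; rewrite gt_eqF.
    rewrite ltr_pdivlMr // mulrC -ltrBlDl (lt_trans tr) //.
    by rewrite ltr_pM2l.
  + subst t; rewrite perspE // /epi_scale eqxx; case: eqP => [y_eq0|_]; last exact: ltry.
    by move: yD; rewrite y_eq0 dot0l => hD; exfalso; lra.
Qed.

(** Real upper bounds p and q instead of the values of [k] keep the criterion meaningful when both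
    infinities occur. *)
Lemma convex_funP (R : realType) (n : nat) (k : 'rV[R]_n -> \bar R) :
  convex_fun k <->
  forall x y (p q t : R), (0 <= t <= 1)%R -> k x <= p%:E -> k y <= q%:E ->
    k (t *: x + (1 - t) *: y)%R <= (t * p + (1 - t) * q)%:E.
Proof.
split=> [ck x y p q t /andP[t0 t1] kx ky|ck [x p] [y q] t].
  have := ck (x, p) (y, q) (Itv01 t0 t1); rewrite !inE /=.
  by move=> /(_ kx ky).
rewrite !inE /epi /= => kx ky.
by apply: ck => //; rewrite ge0 le1.
Qed.

(** A quadratic lower bound is thereby a convex minorant, which is how [quad_minorized] passes to
    hulls and infimal convolutions. *)
Lemma quad_convex (R : realType) (n : nat) (c a : R) :
  (0 <= a)%R ->
  convex_fun (fun x : 'rV[R]_n => (c + a * dot x x)%:E).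
Proof.
move=> a0; apply/convex_funP => x y p q t /andP[t0 t1].
rewrite !lee_fin => xp yq.
have t1' : (0 <= 1 - t)%R by rewrite subr_ge0.
apply: (@le_trans _ _ (t * (c + a * dot x x) + (1 - t) * (c + a * dot y y))%R);
  last by apply: lerD; apply: ler_wpM2l.
rewrite -subr_ge0.
have -> : (t * (c + a * dot x x) + (1 - t) * (c + a * dot y y)
  - (c + a * dot (t *: x + (1 - t) *: y) (t *: x + (1 - t) *: y)) =
  a * (t * (1 - t) * dot (x - y) (x - y)))%R by rewrite -dot_convex; ring.
by rewrite !mulr_ge0 ?dot_ge0.
Qed.

Lemma affine_convex (R : realType) (n : nat) (l : R) (p : 'rV[R]_n) :
  convex_fun (fun x : 'rV[R]_n => (l + dot x p)%:E).
Proof.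
apply/convex_funP => x y r s t /andP[t0 t1]; rewrite !lee_fin => xr ys.
have t1' : (0 <= 1 - t)%R by rewrite subr_ge0.
rewrite dotDl !dotZl.
apply: (@le_trans _ _ (t * (l + dot x p) + (1 - t) * (l + dot y p))%R);
  last by apply: lerD; apply: ler_wpM2l.
by rewrite le_eqVlt; apply/orP; left; apply/eqP; ring.
Qed.

Lemma epi_scale_gtNy (R : realType) (n : nat) (h : 'rV[R]_n -> \bar R) t y :
  (forall x, -oo < h x) -> (0 <= t)%R -> -oo < epi_scale t h y.
Proof.
move=> hN; rewrite le_eqVlt /epi_scale => /orP[/eqP<-|t0].
  by rewrite eqxx; case: eqP => _; rewrite ?ltNyr.
rewrite gt_eqF //; have := hN (t^-1 *: y)%R.
case: (h _) => [r| |] // _; first by rewrite -EFinM ltNyr.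
by rewrite gt0_muley ?lte_fin.
Qed.

Lemma epi_scale_le (R : realType) (n : nat) (h : 'rV[R]_n -> \bar R) t u (p : R) :
  (0 <= t)%R -> h u <= p%:E -> epi_scale t h (t *: u)%R <= (t * p)%:E.
Proof.
rewrite le_eqVlt /epi_scale => /orP[/eqP<-|t0] hu.
  by rewrite scale0r mul0r !eqxx.
rewrite gt_eqF // scalerA mulVf ?gt_eqF // scale1r EFinM.
by rewrite lee_pmul2l ?lte_fin.
Qed.

(** Turns a value below +oo into a scaled point of the epigraph, in the same form for t = 0 and t >
    0. *)
Lemma epi_scale_ltyP (R : realType) (n : nat) (h : 'rV[R]_n -> \bar R) t y :
  proper_fun h -> (0 <= t)%R -> epi_scale t h y < +oo ->
  exists u (p : R), [/\ h u <= p%:E, y = (t *: u)%R &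
                       epi_scale t h y = (t * p)%:E].
Proof.
move=> [hN [u0 hu0]]; rewrite le_eqVlt /epi_scale => /orP[/eqP<-|t0].
  (* At t = 0 both the point and its height are multiplied by 0, so any point of the domain
     serves. *)
  rewrite eqxx; case: eqP => // -> _; exists u0, (fine (h u0)).
  by rewrite fineK ?mul0r ?scale0r // fin_real // hN hu0.
rewrite gt_eqF //; have := hN (t^-1 *: y)%R.
case hr : (h (t^-1 *: y)%R) => [r| |] // _.
  move=> _; exists (t^-1 *: y)%R, r.
  by rewrite hr scalerA divff ?gt_eqF // scale1r -EFinM.
by rewrite gt0_muley ?lte_fin // ltxx.
Qed.

Lemma epi_scale_add_ltyP (R : realType) (n : nat) (h k : 'rV[R]_n -> \bar R)
    t y z :
  proper_fun h -> proper_fun k -> (0 <= t <= 1)%R ->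
  epi_scale t h y + epi_scale (1 - t)%R k z < +oo ->
  exists u v (p q : R), [/\ h u <= p%:E, k v <= q%:E,
    y = (t *: u)%R, z = ((1 - t) *: v)%R &
    epi_scale t h y + epi_scale (1 - t)%R k z = (t * p + (1 - t) * q)%:E].
Proof.
move=> hp kp /andP[t0 t1].
have t1' : (0 <= 1 - t)%R by rewrite subr_ge0.
move=> hk.
have hy : epi_scale t h y < +oo.
  rewrite ltey; apply: contraTN hk => /eqP ->.
  by rewrite addye ?ltxx // gt_eqF // epi_scale_gtNy //; case: kp.
have kz : epi_scale (1 - t)%R k z < +oo.
  rewrite ltey; apply: contraTN hk => /eqP ->.
  by rewrite addey ?ltxx // gt_eqF // epi_scale_gtNy //; case: hp.
have [u [p [hu yu ->]]] := epi_scale_ltyP hp t0 hy.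
have [v [q [kv zv ->]]] := epi_scale_ltyP kp t1' kz.
by exists u, v, p, q; split; rewrite -?EFinD.
Qed.

Lemma epi_scale_add_ge_convex (R : realType) (n : nat)
    (h1 h2 k : 'rV[R]_n -> \bar R) t y z :
  proper_fun h1 -> proper_fun h2 -> convex_fun k ->
  (forall x, k x <= h1 x) -> (forall x, k x <= h2 x) -> (0 <= t <= 1)%R ->
  k (y + z)%R <= epi_scale t h1 y + epi_scale (1 - t)%R h2 z.
Proof.
move=> h1p h2p /convex_funP ck kh1 kh2 t01; rewrite leNgt; apply/negP => lt.
have [u [v [p [q [hu hv yu zv E]]]]] :=
  epi_scale_add_ltyP h1p h2p t01 (lt_le_trans lt (leey _)).
move: lt; rewrite E yu zv ltNge => /negP; apply.
by apply: ck => //; [exact: le_trans hu|exact: le_trans hv].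
Qed.

Lemma persp_gtNy (R : realType) (n : nat) (h : 'rV[R]_n -> \bar R) p :
  (forall x, -oo < h x) -> -oo < persp h p.
Proof.
move=> hN; rewrite /persp; case: (ltP p.1 0%R) => p0; first by rewrite ltNye.
exact: epi_scale_gtNy.
Qed.

Lemma quad_minorized_gtNy (R : realType) (n : nat) (c a : R)
    (h : 'rV[R]_n -> \bar R) :
  quad_minorized c a h -> forall x, -oo < h x.
Proof. by move=> hq x; apply: lt_le_trans (hq x); rewrite ltNyr. Qed.

(** For 0 < t <= 1, t (c + a |y/t|^2) = t c + a |y|^2/t, where t c >= -|c| and |y|^2/t >= |y|^2. The
    bound is uniform in t, which confines the relevant parameters to a compact set. *)
Lemma epi_scale_quad_minorized (R : realType) (n : nat) (c a : R)
    (h : 'rV[R]_n -> \bar R) t y :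
  (0 <= a)%R -> quad_minorized c a h -> (0 <= t <= 1)%R ->
  (- `|c| + a * dot y y)%:E <= epi_scale t h y.
Proof.
move=> a0 hq /andP[]; rewrite le_eqVlt /epi_scale => /orP[/eqP<- _|t0 t1].
  rewrite eqxx; case: eqP => [->|_]; last exact: leey.
  by rewrite dot0l mulr0 addr0 lee_fin oppr_le0.
rewrite gt_eqF //.
have := hq (t^-1 *: y)%R; rewrite -(@lee_pmul2l _ t%:E) ?lte_fin //.
apply: le_trans; rewrite -EFinM lee_fin dotZl dotZr mulrDr.
apply: lerD.
  rewrite -(normrN c) lerNl -mulrN (le_trans (ler_norm _)) //.
  by rewrite normrM (ger0_norm (ltW t0)) ler_piMl.
have -> : (t * (a * (t^-1 * (t^-1 * dot y y))) = a * dot y y / t)%R.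
  by field; rewrite gt_eqF.
by rewrite ler_pdivlMr // ler_piMr // mulr_ge0 ?dot_ge0.
Qed.

(** The infimum of t h1(y) + (1 - t) h2(z) over t y + (1 - t) z = x, with u = (t, t y) as variable.
    For t outside [0, 1] one perspective is +oo, so u may range over the whole space, as
    [lsc_ereal_inf] requires. *)
Definition hull_step (R : realType) (n : nat) (h1 h2 : 'rV[R]_n -> \bar R)
    (x : 'rV[R]_n) : \bar R :=
  ereal_inf [set persp h1 u + persp h2 (1 - u.1, x - u.2)%R |
             u in [set: R * 'rV[R]_n]].

Lemma hull_step_le (R : realType) (n : nat) (h1 h2 : 'rV[R]_n -> \bar R)
    (u v : 'rV[R]_n) (p q t : R) :
  (0 <= t <= 1)%R -> h1 u <= p%:E -> h2 v <= q%:E ->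
  hull_step h1 h2 (t *: u + (1 - t) *: v)%R <= (t * p + (1 - t) * q)%:E.
Proof.
move=> /andP[t0 t1] hu hv; apply: ge_ereal_inf.
have t1' : (0 <= 1 - t)%R by rewrite subr_ge0.
exists (persp h1 (t, t *: u)%R + persp h2 (1 - t, (1 - t) *: v)%R).
  by exists (t, t *: u)%R => //=; rewrite addrAC subrr add0r.
by rewrite EFinD !perspE // leeD // epi_scale_le.
Qed.

Lemma hull_step_le_left (R : realType) (n : nat) (h1 h2 : 'rV[R]_n -> \bar R) x :
  hull_step h1 h2 x <= h1 x.
Proof.
apply: ge_ereal_inf; exists (persp h1 (1, x)%R + persp h2 (0, 0)%R).
  by exists (1, x)%R => //=; rewrite !subrr.
rewrite !perspE // /epi_scale !eqxx oner_eq0 invr1 scale1r mul1e.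
by rewrite adde0.
Qed.

Lemma hull_step_ge_convex (R : realType) (n : nat)
    (h1 h2 k : 'rV[R]_n -> \bar R) :
  proper_fun h1 -> proper_fun h2 -> convex_fun k ->
  (forall x, k x <= h1 x) -> (forall x, k x <= h2 x) ->
  forall x, k x <= hull_step h1 h2 x.
Proof.
move=> h1p h2p ck kh1 kh2 x; apply: le_ereal_inf_tmp => _ [[t y] _ <-] /=.
have [t0|t0] := ltP t 0%R.
  rewrite {1}/persp /= t0 addye ?leey // gt_eqF // persp_gtNy //.
  by case: h2p.
have [t1|t1] := ltP 1%R t.
  rewrite [X in _ <= _ + X]/persp /= subr_lt0 t1 addey ?leey // gt_eqF //.
  by rewrite persp_gtNy //; case: h1p.
rewrite !perspE ?subr_ge0 // -{1}(subrKC y x) epi_scale_add_ge_convex //.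
by rewrite t0 t1.
Qed.

Lemma hull_step_lsc (R : realType) (n : nat) (c a : R)
    (h1 h2 : 'rV[R]_n -> \bar R) :
  (0 < a)%R -> quad_minorized c a h1 -> quad_minorized c a h2 ->
  lower_semicontinuous h1 -> lower_semicontinuous h2 ->
  lower_semicontinuous (hull_step h1 h2).
Proof.
move=> a0 q1 q2 l1 l2.
have N1 := quad_minorized_gtNy q1; have N2 := quad_minorized_gtNy q2.
pose f (p : 'rV[R]_n * (R * 'rV[R]_n)) :=
  persp h1 p.2 + persp h2 (1 - p.2.1, p.1 - p.2.2)%R.
have c1 := @prod_fst_continuous 'rV[R]_n (R * 'rV[R]_n)%type.
have c2 := @prod_snd_continuous 'rV[R]_n (R * 'rV[R]_n)%type.
have c3 := @prod_fst_continuous R 'rV[R]_n.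
have c4 := @prod_snd_continuous R 'rV[R]_n.
have fl : lower_semicontinuous f.
  apply: lsc_add => [p|p||]; try exact: persp_gtNy.
    apply: (@lsc_comp _ _ _ (persp h1) snd) => //.
    exact: persp_lsc q1 l1.
  apply: (@lsc_comp _ _ _ (persp h2)
    (fun p : 'rV[R]_n * (R * 'rV[R]_n) => (1 - p.2.1, p.1 - p.2.2)%R)).
    have c5 : continuous (fun p : 'rV[R]_n * (R * 'rV[R]_n) => 1 - p.2.1)%R.
      move=> p; apply: cvgB; first by apply: cvg_cst.
      by apply: (@continuous_comp _ _ _ snd fst); [exact: c2|exact: c3].
    have c6 : continuous (fun p : 'rV[R]_n * (R * 'rV[R]_n) => p.1 - p.2.2)%R.
      move=> p; apply: cvgB; first exact: c1.
      by apply: (@continuous_comp _ _ _ snd snd); [exact: c2|exact: c4].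
    exact: pair_continuous.
  exact: persp_lsc q2 l2.
apply: (lsc_ereal_inf fl) => x r.
(* Each of the two uniform bounds contributes -|c|; the term a |x' - y|^2 >= 0 is dropped. *)
have [K cK KP] := @compact_dot_le R n ((r + 2 * `|c|) / a)%R.
exists setT, ([set` `[0%R, 1%R]] `*` K); split.
- exact: filterT.
- by apply: compact_setX => //; exact: segment_compact.
move=> x' [t y] _; rewrite /f /= => le.
have t0 : (0 <= t)%R.
  rewrite leNgt; apply/negP => t0; move: le.
  by rewrite {1}/persp /= t0 addye ?leye_eq // gt_eqF // persp_gtNy.
have t1 : (t <= 1)%R.
  rewrite leNgt; apply/negP => t1; move: le.
  rewrite [X in _ + X <= _]/persp /= subr_lt0 t1 addey ?leye_eq // gt_eqF //.
  exact: persp_gtNy.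
split; first by rewrite /= in_itv /= t0 t1.
apply: KP; rewrite ler_pdivlMr // mulrC.
move: le; rewrite !perspE ?subr_ge0 // => le.
have b1 : (- `|c| + a * dot y y)%:E <= epi_scale t h1 y.
  by apply: (epi_scale_quad_minorized _ _ q1); [exact: ltW|rewrite t0 t1].
have b2 : (- `|c| + a * dot (x' - y) (x' - y))%:E
          <= epi_scale (1 - t)%R h2 (x' - y)%R.
  apply: (epi_scale_quad_minorized _ _ q2); first exact: ltW.
  by rewrite subr_ge0 t1 gerBl.
have := le_trans (leeD b1 b2) le; rewrite -EFinD lee_fin.
have : (0 <= a * dot (x' - y) (x' - y))%R by rewrite mulr_ge0 ?dot_ge0 // ltW.
lra.
Qed.

(** * Convex hulls of coercive functions *)

(** After k steps combinations of k + 1 points are covered, so k = n is Caratheodory's count. Adding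
    one point at a time keeps each step an infimum of two perspectives. *)
Definition hull_iter (R : realType) (n : nat) (h : 'rV[R]_n -> \bar R)
    (k : nat) : 'rV[R]_n -> \bar R :=
  iter k (fun h' => hull_step h' h) h.

Lemma hull_iter_le (R : realType) (n : nat) (h : 'rV[R]_n -> \bar R) j k x :
  (j <= k)%N -> hull_iter h k x <= hull_iter h j x.
Proof.
elim: k => [|k IH]; first by rewrite leqn0 => /eqP->.
rewrite leq_eqVlt => /predU1P[->//|/IH]; apply: le_trans.
exact: hull_step_le_left.
Qed.

Lemma quad_minorized_proper (R : realType) (n : nat) (c a : R)
    (h k : 'rV[R]_n -> \bar R) :
  quad_minorized c a h -> (forall x, h x <= k x) -> proper_fun k -> proper_fun h.
Proof.
move=> hq hk [_ [x kx]]; split; first exact: quad_minorized_gtNy hq.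
by exists x; exact: le_lt_trans (hk x) kx.
Qed.

(** Both conclusions go through one induction: the step for [k] requires a proper iterate, and
    properness comes from the quadratic bound. *)
Lemma hull_iter_ge_convex (R : realType) (n : nat) (c a : R)
    (h k : 'rV[R]_n -> \bar R) j :
  (0 < a)%R -> quad_minorized c a h -> proper_fun h -> convex_fun k ->
  (forall x, k x <= h x) ->
  quad_minorized c a (hull_iter h j) /\ forall x, k x <= hull_iter h j x.
Proof.
move=> a0 hq hp ck kh; elim: j => [|j [IHq IHk]] //.
have ip : proper_fun (hull_iter h j).
  by apply: quad_minorized_proper IHq _ hp => x; exact: (@hull_iter_le _ _ h 0).
split.
  apply: (@hull_step_ge_convex R n _ _ (fun u => (c + a * dot u u)%:E)) => //.
  exact: quad_convex (ltW a0).
exact: hull_step_ge_convex.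
Qed.

Lemma hull_iter_lsc (R : realType) (n : nat) (c a : R)
    (h : 'rV[R]_n -> \bar R) j :
  (0 < a)%R -> quad_minorized c a h -> proper_fun h ->
  lower_semicontinuous h -> lower_semicontinuous (hull_iter h j).
Proof.
move=> a0 hq hp hl; elim: j => [|j IH] //.
apply: (hull_step_lsc a0 _ hq IH hl).
by have [] := hull_iter_ge_convex j a0 hq hp (@quad_convex R n c a (ltW a0)) hq.
Qed.

(** Amounts to (x, r) being a convex combination of N points of [epi h]; the last clause leaves room
    for slack. *)
Definition comb (R : realType) (n : nat) (h : 'rV[R]_n -> \bar R) (N : nat)
    (x : 'rV[R]_n) (r : R) : Prop :=
  exists (w : 'I_N -> R) (p : 'I_N -> 'rV[R]_n) (v : 'I_N -> R),
    [/\ forall i, (0 <= w i)%R, (\sum_i w i = 1)%R,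
        forall i, h (p i) <= (v i)%:E, x = (\sum_i w i *: p i)%R &
        (\sum_i w i * v i <= r)%R].

(** The last point is split off and the remaining weights are divided by their sum [t]. *)
Lemma comb_hull_iter (R : realType) (n : nat) (h : 'rV[R]_n -> \bar R) k x r :
  comb h k.+1 x r -> hull_iter h k x <= r%:E.
Proof.
elim: k x r => [|k IH] x r [w [p [v [w0 w1 hv -> le_r]]]].
  move: w1 le_r; rewrite !big_ord1 => w1; rewrite w1 mul1r scale1r => vr.
  by apply: le_trans (hv _) _; rewrite lee_fin.
apply: (@le_trans _ _ (\sum_i w i * v i)%:E); last by rewrite lee_fin.
move: w1; rewrite !(@big_ord_recr _ _ _ k.+1) /=.
set t := (\sum_(i < k.+1) _)%R; set X := (\sum_(i < k.+1) _ *: _)%R.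
set S := (\sum_(i < k.+1) _ * _)%R => w1.
have t0 : (0 <= t)%R by exact: sumr_ge0.
have -> : w ord_max = (1 - t)%R by rewrite -w1 addrAC subrr add0r.
have t01 : (0 <= t <= 1)%R by rewrite t0 /= -w1 lerDl w0.
have [u [q [hu -> ->]]] : exists u (q : R),
    [/\ hull_iter h k u <= q%:E, X = (t *: u)%R & S = (t * q)%R].
  have [t_eq0|t_gt0] := eqVneq t 0%R; last first.
    exists (t^-1 *: X)%R, (t^-1 * S)%R.
    split; rewrite ?scalerA ?mulrA ?divff ?scale1r ?mul1r //.
    apply: IH; exists (fun i => t^-1 * w (widen_ord (leqnSn _) i))%R.
    exists (fun i => p (widen_ord (leqnSn _) i)).
    exists (fun i => v (widen_ord (leqnSn _) i)); split => //.
    - by move=> i; rewrite mulr_ge0 ?invr_ge0.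
    - by rewrite -mulr_sumr mulVf.
    - by rewrite scaler_sumr; apply: eq_bigr => i _; rewrite scalerA.
    - by rewrite mulr_sumr; apply: ler_sum => i _; rewrite mulrA.
  have wE i : w (widen_ord (leqnSn k.+1) i) = 0%R.
    by apply: (psumr_eq0P _ t_eq0).
  (* For t = 0 all remaining weights vanish and any of the points will do. *)
  exists (p ord0), (v ord0); split.
  - by apply: le_trans (hv _); exact: (@hull_iter_le _ _ h 0).
  - by rewrite t_eq0 scale0r; apply: big1 => i _; rewrite wE scale0r.
  - by rewrite t_eq0 mul0r; apply: big1 => i _; rewrite wE mul0r.
by apply: hull_step_le.
Qed.

(** The appended column of ones turns a linear dependence of the N rows in dimension n + 1 into an
    affine one. *)
Lemma exists_affine_dependence (R : realType) (n N : nat)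
    (p : 'I_N -> 'rV[R]_n) :
  (n.+1 < N)%N ->
  exists m : 'I_N -> R, [/\ exists i, m i != 0%R, (\sum_i m i = 0)%R &
                           (\sum_i m i *: p i = 0)%R].
Proof.
move=> nN.
pose A : 'M[R]_(N, n + 1) := row_mx (\matrix_i p i)%R (const_mx 1%R).
have : kermx A != 0%R.
  rewrite kermx_eq0 -row_leq_rank -ltnNge.
  by apply: leq_ltn_trans (rank_leq_col _) _; rewrite addn1.
move=> /rowV0Pn[m /sub_kermxP]; rewrite mul_mx_row.
rewrite -[RHS](@row_mx0 R 1 n 1) => /eq_row_mx[m1 m2] m0.
exists (fun i => m ord0 i); split.
- apply/existsP; apply: contraNT m0; rewrite negb_exists => /forallP m0.
  by apply/eqP/rowP => i; rewrite mxE; apply/eqP; rewrite -[_ == _]negbK.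
- move/rowP/(_ ord0): m2; rewrite mxE mxE => m2; rewrite -[RHS]m2.
  by apply: eq_bigr => i _; rewrite mxE mulr1.
- rewrite -[RHS]m1 mulmx_sum_row.
  by apply: eq_bigr => i _; rewrite rowK.
Qed.

(** Epigraphs have dimension n + 1, where Caratheodory's theorem would stop at n + 2 points. Only an
    upper bound on the height has to be kept, and this saves one point. *)
Lemma comb_caratheodory (R : realType) (n : nat) (h : 'rV[R]_n -> \bar R) N x r :
  (n < N)%N -> comb h N.+1 x r -> comb h N x r.
Proof.
move=> nN [w [p [v [w0 w1 hv -> le_r]]]].
(* The sign of the dependence is chosen so that moving the weights along [m] does not raise the
   height. *)
have [m [m0 msum mp mv]] : exists m : 'I_N.+1 -> R,
    [/\ exists i, m i != 0%R, (\sum_i m i = 0)%R,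
        (\sum_i m i *: p i = 0)%R & (\sum_i m i * v i <= 0)%R].
  have [m [[i mi] msum mp]] := exists_affine_dependence p (nN : (n.+1 < N.+1)%N).
  have [mv|/ltW mv] := leP (\sum_i m i * v i)%R 0%R.
    by exists m; split => //; exists i.
  exists (fun i => - m i)%R; split.
  - by exists i; rewrite oppr_eq0.
  - by rewrite sumrN msum oppr0.
  - by under eq_bigr do rewrite scaleNr; rewrite sumrN mp oppr0.
  - by under eq_bigr do rewrite mulNr; rewrite sumrN oppr_le0.
have [i0 i0_neg] : exists i, (m i < 0)%R.
  apply: contrapT => noneg; case: m0 => i /eqP; apply.
  apply: (psumr_eq0P _ msum) => // j _.
  by rewrite leNgt; apply/negP => mj; apply: noneg; exists j.
(* Ratio test: the minimal quotient is the largest step that keeps all weights nonnegative, and it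
   annihilates the weight of [i]. *)
have [i mi imin] := @arg_minP _ R _ i0 (fun i => m i < 0)%R
  (fun i => w i / - m i)%R i0_neg.
pose s := (w i / - m i)%R; pose w' j := (w j + s * m j)%R.
have s0 : (0 <= s)%R by rewrite divr_ge0 // oppr_ge0 ltW.
have w'i : w' i = 0%R.
  by rewrite /w' /s; field; rewrite lt_eqF // oppr_eq0 lt_eqF.
have w'0 j : (0 <= w' j)%R.
  rewrite /w'; have [mj|mj] := leP 0%R (m j).
    by rewrite addr_ge0 // mulr_ge0.
  have := imin _ mj; rewrite -/s ler_pdivlMr ?oppr_gt0 // mulrN.
  by rewrite -subr_ge0 opprK.
exists (fun j => w' (lift i j)), (fun j => p (lift i j)), (fun j => v (lift i j)).
have lift_sum (V : zmodType) (F : 'I_N.+1 -> V) : F i = 0%R ->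
    (\sum_(j < N) F (lift i j) = \sum_j F j)%R.
  by move=> Fi; rewrite [RHS](bigD1_ord i) //= Fi add0r.
split => //.
- rewrite (lift_sum _ w') // /w' big_split /= -mulr_sumr msum mulr0 addr0 //.
- rewrite (lift_sum _ (fun j => w' j *: p j)%R) ?w'i ?scale0r //.
  under [RHS]eq_bigr do rewrite scalerDl -scalerA.
  by rewrite big_split /= -scaler_sumr mp scaler0 addr0.
- rewrite (lift_sum _ (fun j => w' j * v j)%R) ?w'i ?mul0r //.
  under eq_bigr do rewrite mulrDl -mulrA.
  rewrite big_split /= -mulr_sumr; apply: le_trans le_r.
  by rewrite gerDl mulr_ge0_le0.
Qed.

Lemma comb_le_hull_iter (R : realType) (n : nat) (h : 'rV[R]_n -> \bar R) N x r :
  comb h N x r -> hull_iter h n x <= r%:E.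
Proof.
elim: N => [|N IH].
  by move=> [w [p [v [_ /esym/eqP]]]]; rewrite big_ord0 oner_eq0.
have [nN /(comb_caratheodory nN)/IH//|Nn /comb_hull_iter] := ltnP n N.
by apply: le_trans; exact: hull_iter_le.
Qed.

Lemma comb_convex (R : realType) (n : nat) (h : 'rV[R]_n -> \bar R) N M x y r s t :
  (0 <= t <= 1)%R -> comb h N x r -> comb h M y s ->
  comb h (N + M) (t *: x + (1 - t) *: y)%R (t * r + (1 - t) * s)%R.
Proof.
move=> /andP[t0 t1] [w [p [v [w0 w1 hv -> le_r]]]].
move=> [w' [p' [v' [w'0 w'1 hv' -> le_s]]]].
have t1' : (0 <= 1 - t)%R by rewrite subr_ge0.
pose glue (T : Type) (a : 'I_N -> T) (b : 'I_M -> T) (i : 'I_(N + M)) :=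
  match fintype.split i with inl j => a j | inr j => b j end.
have gl T a b i : @glue T a b (lshift M i) = a i.
  by rewrite /glue (unsplitK (inl i : 'I_N + 'I_M)%type).
have gr T a b i : @glue T a b (rshift N i) = b i.
  by rewrite /glue (unsplitK (inr i : 'I_N + 'I_M)%type).
exists (glue _ (fun i => t * w i)%R (fun i => (1 - t) * w' i)%R).
exists (glue _ p p'), (glue _ v v'); split.
- by move=> i; rewrite /glue; case: fintype.split => j; rewrite mulr_ge0.
- rewrite big_split_ord /=; under eq_bigr do rewrite gl.
  under [X in (_ + X)%R]eq_bigr do rewrite gr.
  by rewrite -!mulr_sumr w1 w'1 !mulr1 subrKC.
- by move=> i; rewrite /glue; case: fintype.split => j.
- by rewrite big_split_ord /= !scaler_sumr; congr (_ + _)%R;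
    apply: eq_bigr => i _; rewrite ?gl ?gr scalerA.
- rewrite big_split_ord /=; apply: lerD.
    apply: le_trans (ler_wpM2l t0 le_r); rewrite mulr_sumr.
    by apply: ler_sum => i _; rewrite !gl mulrA.
  apply: le_trans (ler_wpM2l t1' le_s); rewrite mulr_sumr.
  by apply: ler_sum => i _; rewrite !gr mulrA.
Qed.

(** The infimum [k] over combinations of any length is convex because combinations concatenate, so
    it lies below [conv_fun h]; Caratheodory puts the n-th iterate below [k]. *)
Lemma hull_iter_le_conv_fun (R : realType) (n : nat) (h : 'rV[R]_n -> \bar R) x :
  (forall y, -oo < h y) -> hull_iter h n x <= conv_fun h x.
Proof.
move=> hN; pose k (x : 'rV[R]_n) :=
  ereal_inf [set r%:E | r in [set r | exists N, comb h N x r]].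
have kP y (s e : R) : (0 < e)%R -> k y <= s%:E -> exists N, comb h N y (s + e)%R.
  move=> e0 ks; have : k y < (s + e)%:E.
    by apply: le_lt_trans ks _; rewrite lte_fin ltrDl.
  move=> /ereal_inf_lt[_ [r [N [w [p [v [w0 w1 hv yE vr]]]]] <-]].
  rewrite lte_fin => rs; exists N, w, p, v; split => //.
  by rewrite (le_trans vr) // ltW.
have kconv : convex_fun k.
  apply/convex_funP => y z p q t t01 kp kq; apply/lee_addgt0Pr => e e0.
  have [N cN] := kP _ _ _ e0 kp; have [M cM] := kP _ _ _ e0 kq.
  apply: ereal_inf_lbound; exists (t * p + (1 - t) * q + e)%R => //.
  exists (N + M)%N; have := comb_convex t01 cN cM.
  by congr comb; ring.
have kh y : k y <= h y.
  apply/lee_addgt0Pr => e e0; have := hN y.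
  case hy : (h y) => [s| |] // _; rewrite ?leey //.
  rewrite -EFinD; apply: ge_ereal_inf; exists (s + e)%:E => //.
    exists (s + e)%R => //; exists 1%N, (fun=> 1%R), (fun=> y), (fun=> s).
    by split => //; rewrite ?big_ord1 ?scale1r // ?mul1r ?hy // lerDl ltW.
apply: le_trans (conv_fun_max kconv kh x).
apply: le_ereal_inf_tmp => _ [r [N c] <-]; exact: comb_le_hull_iter c.
Qed.

Lemma conv_funE (R : realType) (n : nat) (c a : R) (h : 'rV[R]_n -> \bar R) :
  (0 < a)%R -> quad_minorized c a h -> proper_fun h ->
  conv_fun h = hull_iter h n.
Proof.
move=> a0 hq hp; apply/funext => x; apply/eqP; rewrite eq_le.
rewrite hull_iter_le_conv_fun ?andbT; last by case: hp.
have [_ ->//] := hull_iter_ge_convex n a0 hq hp (@conv_fun_convex _ _ h)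
  (@conv_fun_le _ _ h).
Qed.

Lemma conv_fun_quad_minorized (R : realType) (n : nat) (c a : R)
    (h : 'rV[R]_n -> \bar R) :
  (0 <= a)%R -> quad_minorized c a h -> quad_minorized c a (conv_fun h).
Proof.
move=> a0 hq u.
exact: (conv_fun_max (k := fun u => (c + a * dot u u)%:E) (@quad_convex R n c a a0)).
Qed.

Lemma conv_fun_lsc (R : realType) (n : nat) (c a : R) (h : 'rV[R]_n -> \bar R) :
  (0 < a)%R -> quad_minorized c a h -> proper_fun h ->
  lower_semicontinuous h -> lower_semicontinuous (conv_fun h).
Proof.
by move=> a0 hq hp hl; rewrite (conv_funE a0 hq hp); exact: hull_iter_lsc hq _ _.
Qed.

(** * Infimal convolutions *)

Lemma lsc_attains_global_min (R : realType) (T : topologicalType)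
    (f : T -> \bar R) (K : set T) (r : \bar R) (z : T) :
  lower_semicontinuous f -> compact K -> f z <= r ->
  (forall w, f w <= r -> K w) -> exists x, forall y, f x <= f y.
Proof.
move=> fl cK zr rK.
have [|x Kx xmin] := lsc_attains_min fl cK; first by exists z; exact: rK.
exists x => y; have [/rK/xmin//|/ltW] := leP (f y) r; apply: le_trans.
by apply: (le_trans _ zr); apply: xmin; exact: rK.
Qed.

Lemma infconv_le (R : realType) (n : nat) (F G : 'rV[R]_n -> \bar R)
    (t : R) u v (p q : R) :
  (0 <= t <= 1)%R -> F u <= p%:E -> G v <= q%:E ->
  infconv (epi_scale t F) (epi_scale (1 - t)%R G) (t *: u + (1 - t) *: v)%R
    <= (t * p + (1 - t) * q)%:E.
Proof.
move=> /andP[t0 t1] Fu Gv; apply: ge_ereal_inf.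
exists (epi_scale t F (t *: u + (1 - t) *: v - (1 - t) *: v)%R
  + epi_scale (1 - t)%R G ((1 - t) *: v)%R); first by exists ((1 - t) *: v)%R.
rewrite addrK EFinD; apply: leeD; apply: epi_scale_le => //.
by rewrite subr_ge0.
Qed.

Lemma infconv_ge_convex (R : realType) (n : nat)
    (F G k : 'rV[R]_n -> \bar R) t :
  proper_fun F -> proper_fun G -> convex_fun k ->
  (forall x, k x <= F x) -> (forall x, k x <= G x) -> (0 <= t <= 1)%R ->
  forall x, k x <= infconv (epi_scale t F) (epi_scale (1 - t)%R G) x.
Proof.
move=> Fp Gp ck kF kG t01 x; apply: le_ereal_inf_tmp => _ [w _ <-].
by rewrite -{1}(subrK w x); exact: epi_scale_add_ge_convex.
Qed.

(** [epi_scale] is a slice of [persp] at fixed t, which settles t = 0 together with t > 0. *)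
Lemma infconv_summand_lsc (R : realType) (n : nat) (c a t : R)
    (F G : 'rV[R]_n -> \bar R) :
  (0 < a)%R -> quad_minorized c a F -> quad_minorized c a G ->
  lower_semicontinuous F -> lower_semicontinuous G -> (0 <= t <= 1)%R ->
  lower_semicontinuous (fun p : 'rV[R]_n * 'rV[R]_n =>
    epi_scale t F (p.1 - p.2)%R + epi_scale (1 - t)%R G p.2).
Proof.
move=> a0 Fq Gq Fl Gl /andP[t0 t1].
have t1' : (0 <= 1 - t)%R by rewrite subr_ge0.
have c1 := @prod_fst_continuous 'rV[R]_n 'rV[R]_n.
have c2 := @prod_snd_continuous 'rV[R]_n 'rV[R]_n.
apply: lsc_add => [p|p||]; try apply: epi_scale_gtNy => //.
- exact: quad_minorized_gtNy Fq.
- exact: quad_minorized_gtNy Gq.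
- have cm : continuous (fun p : 'rV[R]_n * 'rV[R]_n => p.1 - p.2)%R.
    by move=> p; apply: cvgB; [exact: c1|exact: c2].
  have ct : continuous (fun p : 'rV[R]_n * 'rV[R]_n => (t, p.1 - p.2)%R).
    by apply: pair_continuous => //; exact: cst_continuous.
  move=> p b; rewrite -(perspE _ _ t0).
  move=> /(lsc_comp ct (persp_lsc a0 Fq Fl))[V pV VP].
  by exists V => // y /VP; rewrite perspE.
- have ct : continuous (fun p : 'rV[R]_n * 'rV[R]_n => (1 - t, p.2)%R).
    by apply: pair_continuous => //; exact: cst_continuous.
  move=> p b; rewrite -(perspE _ _ t1').
  move=> /(lsc_comp ct (persp_lsc a0 Gq Gl))[V pV VP].
  by exists V => // y /VP; rewrite perspE.
Qed.

(** [K] does not depend on x, so it serves both attainment at a point and the locally uniform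
    condition of [lsc_ereal_inf]. *)
Lemma infconv_summand_bounded (R : realType) (n : nat) (c a t r : R)
    (F G : 'rV[R]_n -> \bar R) :
  (0 < a)%R -> quad_minorized c a F -> quad_minorized c a G -> (0 <= t <= 1)%R ->
  exists2 K : set 'rV[R]_n, compact K &
    forall x w, epi_scale t F (x - w)%R + epi_scale (1 - t)%R G w <= r%:E -> K w.
Proof.
move=> a0 Fq Gq t01; have /andP[t0 t1] := t01.
have [K cK KP] := @compact_dot_le R n ((r + 2 * `|c|) / a)%R.
exists K => // x w le; apply: KP; rewrite ler_pdivlMr // mulrC.
have b1 := epi_scale_quad_minorized (x - w)%R (ltW a0) Fq t01.
have b2 : (- `|c| + a * dot w w)%:E <= epi_scale (1 - t)%R G w.
  apply: (epi_scale_quad_minorized _ _ Gq); first exact: ltW.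
  by rewrite subr_ge0 t1 gerBl.
have := le_trans (leeD b1 b2) le; rewrite -EFinD lee_fin.
have : (0 <= a * dot (x - w) (x - w))%R by rewrite mulr_ge0 ?dot_ge0 // ltW.
lra.
Qed.

Lemma infconv_attained (R : realType) (n : nat) (c a t : R)
    (F G : 'rV[R]_n -> \bar R) :
  (0 < a)%R -> quad_minorized c a F -> quad_minorized c a G ->
  lower_semicontinuous F -> lower_semicontinuous G -> (0 <= t <= 1)%R ->
  infconv_exact (epi_scale t F) (epi_scale (1 - t)%R G).
Proof.
move=> a0 Fq Gq Fl Gl t01 x xdom.
pose f w := epi_scale t F (x - w)%R + epi_scale (1 - t)%R G w.
have [_ [z _ <-] zlt] := ereal_inf_lt xdom.
have [r zr] := lty_le_fin zlt.
have [K cK KP] := infconv_summand_bounded r a0 Fq Gq t01.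
have cx : continuous (fun w : 'rV[R]_n => (x, w)).
  apply: pair_continuous; [exact: cst_continuous|by move=> w A].
have fl : lower_semicontinuous f.
  exact: lsc_comp cx (infconv_summand_lsc a0 Fq Gq Fl Gl t01).
have [w wmin] := lsc_attains_global_min fl cK zr (KP x).
exists w; apply/eqP; rewrite eq_le; apply/andP; split.
  by apply: le_ereal_inf_tmp => _ [y _ <-]; exact: wmin.
by apply: ereal_inf_lbound; exists w.
Qed.

Lemma infconv_lsc (R : realType) (n : nat) (c a t : R)
    (F G : 'rV[R]_n -> \bar R) :
  (0 < a)%R -> quad_minorized c a F -> quad_minorized c a G ->
  lower_semicontinuous F -> lower_semicontinuous G -> (0 <= t <= 1)%R ->
  lower_semicontinuous (infconv (epi_scale t F) (epi_scale (1 - t)%R G)).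
Proof.
move=> a0 Fq Gq Fl Gl t01.
apply: (lsc_ereal_inf (infconv_summand_lsc a0 Fq Gq Fl Gl t01)) => x r.
have [K cK KP] := infconv_summand_bounded r a0 Fq Gq t01.
by exists setT, K; split=> [||y u _]; [exact: filterT|exact: cK|exact: KP].
Qed.

(** Attainment yields the inclusion from left to right, where boundary points must be decomposed
    without loss. *)
Lemma epi_infconv (R : realType) (n : nat) (c a t : R)
    (F G : 'rV[R]_n -> \bar R) :
  (0 < a)%R -> quad_minorized c a F -> quad_minorized c a G ->
  lower_semicontinuous F -> lower_semicontinuous G ->
  proper_fun F -> proper_fun G -> (0 <= t <= 1)%R ->
  epi (infconv (epi_scale t F) (epi_scale (1 - t)%R G)) =
  set_add (set_scale t (epi F)) (set_scale (1 - t)%R (epi G)).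
Proof.
move=> a0 Fq Gq Fl Gl Fp Gp t01; apply/seteqP; split; last first.
  move=> _ [_ [[u p] Fu <-] [_ [[v q] Gv <-] <-]].
  exact: infconv_le.
move=> [x r] /= xr.
have [w wE] := infconv_attained a0 Fq Gq Fl Gl t01 (le_lt_trans xr (ltry r)).
have := le_lt_trans xr (ltry r); rewrite -wE.
move=> /(epi_scale_add_ltyP Fp Gp t01)[u [v [p [q [Fu Gv xu wv E]]]]].
(* The slack is added to both heights: t d + (1 - t) d = d for every t, the endpoints included. *)
pose d := (r - (t * p + (1 - t) * q))%R.
have d0 : (0 <= d)%R by rewrite subr_ge0 -lee_fin -E wE.
exists (t *: (u, p + d : R^o))%R.
  by exists (u, p + d)%R => //=; apply: le_trans Fu _; rewrite lee_fin lerDl.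
exists ((1 - t) *: (v, q + d : R^o))%R.
  by exists (v, q + d)%R => //=; apply: le_trans Gv _; rewrite lee_fin lerDl.
congr pair; rewrite /= -?xu -?wv ?subrK //.
change (t * (p + d) + (1 - t) * (q + d) = r)%R; rewrite /d; ring.
Qed.

Lemma infconv_convex (R : realType) (n : nat) (c a t : R)
    (F G : 'rV[R]_n -> \bar R) :
  (0 < a)%R -> quad_minorized c a F -> quad_minorized c a G ->
  lower_semicontinuous F -> lower_semicontinuous G ->
  proper_fun F -> proper_fun G -> convex_fun F -> convex_fun G ->
  (0 <= t <= 1)%R ->
  convex_fun (infconv (epi_scale t F) (epi_scale (1 - t)%R G)).
Proof.
move=> a0 Fq Gq Fl Gl Fp Gp /convex_funP cF /convex_funP cG t01.
have E := epi_infconv a0 Fq Gq Fl Gl Fp Gp t01.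
apply/convex_funP => x y p q s s01 xp yq.
have : epi (infconv (epi_scale t F) (epi_scale (1 - t)%R G)) (x, p) by [].
have : epi (infconv (epi_scale t F) (epi_scale (1 - t)%R G)) (y, q) by [].
rewrite E => -[_ [[u1 p1] /= Fu1 <-] [_ [[v1 q1] /= Gv1 <-] [<- <-]]].
move=> [_ [[u2 p2] /= Fu2 <-] [_ [[v2 q2] /= Gv2 <-] [<- <-]]].
have E1 : (t *: (s *: u2 + (1 - s) *: u1) + (1 - t) *: (s *: v2 + (1 - s) *: v1)
  = s *: (t *: u2 + (1 - t) *: v2) + (1 - s) *: (t *: u1 + (1 - t) *: v1))%R.
  by rewrite !scalerDr !scalerA addrACA !(mulrC t) !(mulrC (1 - t)%R).
have E2 : (t * (s * p2 + (1 - s) * p1) + (1 - t) * (s * q2 + (1 - s) * q1) =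
  s * (t * p2 + (1 - t) * q2) + (1 - s) * (t * p1 + (1 - t) * q1))%R by ring.
have := infconv_le t01 (cF _ _ _ _ _ s01 Fu2 Fu1) (cG _ _ _ _ _ s01 Gv2 Gv1).
by rewrite E1 E2.
Qed.

(** * Affine minorants of coercive convex functions *)

Lemma nbhs_dot_lt (R : realType) (n : nat) (x : 'rV[R]_n) (V : set 'rV[R]_n) :
  nbhs x V -> exists2 d : R, (0 < d)%R &
    forall y, (dot (y - x) (y - x) < d)%R -> V y.
Proof.
move=> /nbhs_ballP[e /= e0 eV]; exists (e ^+ 2)%R; first by rewrite exprn_gt0.
move=> y yd; apply: eV; split => // i j; rewrite /ball /= distrC (ord1 i).
rewrite -(@ltr_pXn2r _ 2) ?nnegrE ?real_normK ?num_real // ?ltW //.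
by apply: le_lt_trans yd; have := sqr_coord_le_dot (y - x) j; rewrite !mxE.
Qed.

Lemma sqdist_continuous (R : realType) (n : nat) (k : R) (x : 'rV[R]_n) :
  continuous (fun u : 'rV[R]_n => k * dot (u - x) (u - x))%R.
Proof.
have ci : continuous (fun u : 'rV[R]_n => u) by move=> u; exact: cvg_id.
have cx : continuous (fun u : 'rV[R]_n => x) by exact: cst_continuous.
have cs : continuous (fun u : 'rV[R]_n => u - x)%R.
  by move=> u; exact: cvgB (ci u) (cx u).
have cd : continuous (fun u : 'rV[R]_n => dot (u - x) (u - x))%R.
  move=> u; apply: (@continuous_comp _ _ _ (fun u : 'rV[R]_n => u - x)%R
    (fun u => dot u u)); first exact: cs.
  exact: dot_self_continuous.
have ck : continuous (fun u : 'rV[R]_n => k) by exact: cst_continuous.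
by move=> u; exact: cvgM (ck u) (cd u).
Qed.

(* The minimizer z of Phi + k |. - x|^2 yields the subgradient 2k(x - z) of Phi
   at z; for k large the corresponding affine minorant exceeds r at x, because
   z is close to x or k |z - x|^2 is large. *)
Lemma affine_minorant (R : realType) (n : nat) (c a : R)
    (Phi : 'rV[R]_n -> \bar R) x (r : R) :
  (0 < a)%R -> quad_minorized c a Phi -> lower_semicontinuous Phi ->
  proper_fun Phi -> convex_fun Phi -> r%:E < Phi x ->
  exists p, forall u, (r + dot (u - x) p)%:E <= Phi u.
Proof.
move=> a0 Pq Pl [PN [u0 Pu0]] /convex_funP Pc /Pl[V /nbhs_dot_lt[d d0 dV] rV].
have Pge u : c%:E <= Phi u.
  by apply: le_trans (Pq u); rewrite lee_fin lerDl mulr_ge0 ?dot_ge0 // ltW.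
(* Then k d >= r - c, so at squared distance at least d from x the penalty lifts the lower bound c
   up to r; the summand 1 makes k positive. *)
pose k := ((`|r| + `|c| + 1) / d)%R.
have k0 : (0 < k)%R by rewrite divr_gt0 // ltr_wpDl // addr_ge0.
have kd : (r - c <= k * d)%R.
  rewrite divfK ?gt_eqF //; have := ler_norm r; have := ler_norm (- c).
  by rewrite normrN; lra.
pose psi u := Phi u + (k * dot (u - x) (u - x))%:E.
have psil : lower_semicontinuous psi.
  apply: lsc_add => //; first by move=> u; rewrite ltNyr.
  by apply: lsc_EFin; exact: sqdist_continuous.
have [b0 b0E] : exists b, psi u0 = b%:E.
  rewrite /psi; move: (PN u0) Pu0; rewrite /dom /=; case: (Phi u0) => // b _ _.
  by eexists; rewrite -EFinD.
have [K cK KP] := @compact_dot_le R n ((b0 - c) / a)%R.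
have [||z zmin] := @lsc_attains_global_min R _ psi K b0%:E u0 psil cK.
- by rewrite b0E.
- move=> w wb; apply: KP; rewrite ler_pdivlMr // mulrC lerBrDl -lee_fin.
  apply: le_trans (Pq w) _; apply: le_trans wb; rewrite leeDl // lee_fin.
  by rewrite mulr_ge0 ?dot_ge0 // ltW.
have [s sE] : exists s, Phi z = s%:E.
  have := zmin u0; rewrite b0E /psi; have := PN z.
  by case: (Phi z) => // s _ _; exists s.
(* Comparing [z] with points of the segment from [z] to u gives 0 <= t (A + t B) on [0, 1], hence A
   >= 0, the subgradient inequality. *)
have sub u b : Phi u <= b%:E -> (s + 2 * k * dot (x - z) (u - z) <= b)%R.
  move=> ub; set D := dot _ _; pose B := (k * dot (u - z) (u - z))%R.
  have B0 : (0 <= B)%R by rewrite mulr_ge0 ?dot_ge0 // ltW.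
  pose A := (b - s - 2 * k * D)%R.
  have AB t : (0 <= t <= 1)%R -> (0 <= t * (A + t * B))%R.
    move=> t01; have := zmin (t *: u + (1 - t) *: z)%R.
    have := Pc u z b s t t01 ub; rewrite sE lexx => /(_ isT) h1.
    rewrite /psi sE => h2; have := le_trans h2 (leeD2r _ h1).
    rewrite -!EFinD lee_fin.
    have -> : (t *: u + (1 - t) *: z - x = t *: (u - z) - (x - z))%R.
      by rewrite scalerBl scale1r scalerBr opprB addrA addrAC -!addrA.
    rewrite -(opprB x z) dotNl dotNr opprK.
    rewrite !(dotBl _ (x - z)) !(dotBr _ (x - z)) !(dotZl _ (u - z)) !(dotZr _ (u - z)).
    rewrite (dotC (u - z) (x - z)) -/D /A /B; lra.
  have {AB} : (0 <= A)%R.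
    rewrite leNgt; apply/negP => A0.
    have q0 : (0 < - A + B + 1)%R by lra.
    (* An explicit t > 0 with A + t B < 0, in place of the limit t -> 0. *)
    have t01 : (0 <= - A / (- A + B + 1) <= 1)%R.
      rewrite ler_pdivrMr // mul1r divr_ge0 ?(ltW q0) //=; last by lra.
      by lra.
    have := AB _ t01; rewrite leNgt => /negP; apply.
    rewrite pmulr_rlt0 ?divr_gt0 ?oppr_gt0 //.
    rewrite mulrAC -ltrBrDl sub0r ltr_pdivrMr //.
    by rewrite ltr_pM2l ?oppr_gt0 //; lra.
  by rewrite /A; lra.
have rs : (r <= s + 2 * k * dot (x - z) (x - z))%R.
  have dE : dot (z - x)%R (z - x)%R = dot (x - z)%R (x - z)%R.
    by rewrite -opprB dotNl dotNr opprK.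
  have [zd|zd] := ltP (dot (x - z) (x - z))%R d.
    have Vz : V z by apply: dV; rewrite dE.
    have := rV z Vz; rewrite sE lte_fin => /ltW rs.
    apply: (le_trans rs); rewrite lerDl; apply: mulr_ge0; last exact: dot_ge0.
    by apply: mulr_ge0 => //; exact: ltW.
  have cs : (c <= s)%R by rewrite -lee_fin -sE.
  have : (k * d <= k * dot (x - z) (x - z))%R by rewrite ler_pM2l.
  have : (0 <= k * dot (x - z) (x - z))%R by rewrite mulr_ge0 ?dot_ge0 // ltW.
  lra.
exists (2 * k *: (x - z))%R => u; have := sub u; have := PN u.
case: (Phi u) => [b| |] // _; last by rewrite leey.
move=> /(_ b (lexx _)) h; rewrite lee_fin; apply: le_trans h.
rewrite dotZr -(subrK x u) dotC addrK -addrA [in leRHS]dotDr; lra.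
Qed.

(** * Conjugates and Moreau envelopes *)

Lemma lee_of_fin_le (R : realType) (x y : \bar R) :
  (forall r : R, r%:E < x -> r%:E <= y) -> x <= y.
Proof.
move=> xy; rewrite leNgt; apply/negP; case: y xy => [s| |] xy yx.
- have [b sb bx] := lte_fin_between yx.
  by have := xy b bx; rewrite lee_fin leNgt sb.
- by move: yx; rewrite ltNge leey.
- case: x xy yx => [r| |] // xy _.
    by have := xy (r - 1)%R; rewrite lte_fin gtrBl ltr01 leeNy_eq => /(_ isT).
  by have := xy 0%R (ltry _).
Qed.

Lemma ereal_inf_addr (R : realType) (T : Type) (f : T -> \bar R) (c : R) :
  ereal_inf [set f u + c%:E | u in [set: T]] =
  ereal_inf [set f u | u in [set: T]] + c%:E.
Proof.
apply/eqP; rewrite eq_le; apply/andP; split.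
  rewrite -leeBlDr //; apply: le_ereal_inf_tmp => _ [u _ <-].
  by rewrite leeBlDr //; apply: ereal_inf_lbound; exists u.
apply: le_ereal_inf_tmp => _ [u _ <-]; rewrite leeD2r //.
by apply: ereal_inf_lbound; exists u.
Qed.

(* Minus the convex conjugate of h at p. *)
Definition lconj (R : realType) (n : nat) (h : 'rV[R]_n -> \bar R)
    (p : 'rV[R]_n) : \bar R :=
  ereal_inf [set h u - (dot u p)%:E | u in [set: 'rV[R]_n]].

Lemma lconj_geP (R : realType) (n : nat) (h : 'rV[R]_n -> \bar R) p (r : R) :
  r%:E <= lconj h p <-> forall u, (r + dot u p)%:E <= h u.
Proof.
split=> [rh u|rh].
  by rewrite EFinD -leeBrDr //; apply: le_trans rh _; apply: ereal_inf_lbound; exists u.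
by apply: le_ereal_inf_tmp => _ [u _ <-]; rewrite leeBrDr // -EFinD.
Qed.

Lemma lconj_le (R : realType) (n : nat) (h : 'rV[R]_n -> \bar R) p u (r : R) :
  h u <= r%:E -> lconj h p <= (r - dot u p)%:E.
Proof.
move=> hu; apply: ge_ereal_inf; exists (h u - (dot u p)%:E); first by exists u.
by rewrite EFinB leeB.
Qed.

Lemma lconj_lt_fin (R : realType) (n : nat) (h : 'rV[R]_n -> \bar R) p (r : R) :
  lconj h p < r%:E -> exists u, h u <= (r + dot u p)%:E.
Proof.
move=> /ereal_inf_lt[_ [u _ <-] /ltW ur]; exists u.
by rewrite EFinD -leeBlDr.
Qed.

(** Affine functions are convex, so [h] and its hull have the same affine minorants. *)
Lemma lconj_conv_fun (R : realType) (n : nat) (h : 'rV[R]_n -> \bar R) p :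
  lconj (conv_fun h) p = lconj h p.
Proof.
apply/eqP; rewrite eq_le; apply/andP; split; apply: lee_of_fin_le => r /ltW.
  move=> /lconj_geP rh; apply/lconj_geP => u.
  exact: le_trans (rh u) (conv_fun_le _ _).
move=> /lconj_geP rh; apply/lconj_geP => u.
exact: (conv_fun_max (affine_convex (l := r) (p := p)) rh).
Qed.

Lemma lconj_fin_num (R : realType) (n : nat) (c a : R)
    (h : 'rV[R]_n -> \bar R) p :
  (0 < a)%R -> quad_minorized c a h -> proper_fun h ->
  lconj h p \is a fin_num.
Proof.
move=> a0 hq [hN [u hu]]; apply: fin_real; apply/andP; split.
  (* The minimum of c + a |v|^2 - <v, p>, attained at v = p/(2a). *)
  apply: (@lt_le_trans _ _ (c - dot p p / (4 * a))%:E); first by rewrite ltNyr.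
  apply/lconj_geP => v; apply: le_trans (hq v); rewrite lee_fin.
  have := dot_ge0 (v - (2 * a)^-1 *: p)%R.
  rewrite dotBl !dotBr dotZl !dotZr dotZl (dotC p v) -(pmulr_rge0 _ a0).
  have -> : (a * (dot v v - (2 * a)^-1 * dot v p -
    ((2 * a)^-1 * dot v p - (2 * a)^-1 * ((2 * a)^-1 * dot p p))) =
    a * dot v v - dot v p + dot p p / (4 * a))%R by field; rewrite gt_eqF.
  by lra.
have [r hr] : exists r : R, h u = r%:E.
  by move: (hN u) hu; rewrite /dom /=; case: (h u) => // r _ _; exists r.
by apply: le_lt_trans (ltry (r - dot u p)%R); apply: lconj_le; rewrite hr.
Qed.

Lemma lconj_infconv (R : realType) (n : nat) (t l1 l2 : R)
    (F G : 'rV[R]_n -> \bar R) p :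
  proper_fun F -> proper_fun G -> (0 <= t <= 1)%R ->
  lconj F p = l1%:E -> lconj G p = l2%:E ->
  lconj (infconv (epi_scale t F) (epi_scale (1 - t)%R G)) p =
  (t * l1 + (1 - t) * l2)%:E.
Proof.
move=> Fp Gp t01 Fl Gl; have /andP[t0 t1] := t01.
have t1' : (0 <= 1 - t)%R by rewrite subr_ge0.
apply/eqP; rewrite eq_le; apply/andP; split.
  apply/lee_addgt0Pr => e e0.
  have [u Fu] : exists u, F u <= ((l1 + e) + dot u p)%:E.
    by apply: lconj_lt_fin; rewrite Fl lte_fin ltrDl.
  have [v Gv] : exists v, G v <= ((l2 + e) + dot v p)%:E.
    by apply: lconj_lt_fin; rewrite Gl lte_fin ltrDl.
  apply: le_trans (lconj_le p (infconv_le t01 Fu Gv)) _.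
  rewrite -EFinD lee_fin dotDl !dotZl le_eqVlt; apply/orP; left; apply/eqP.
  by ring.
apply/lconj_geP => x; apply: le_ereal_inf_tmp => _ [w _ <-].
rewrite leNgt; apply/negP => lt.
have [u [v [r [s [Fu Gv xu wv E]]]]] :=
  epi_scale_add_ltyP Fp Gp t01 (lt_le_trans lt (leey _)).
move: lt; rewrite E lte_fin ltNge => /negP; apply.
have : l1%:E <= lconj F p by rewrite Fl.
move=> /lconj_geP/(_ u)/le_trans/(_ Fu); rewrite lee_fin => h1.
have : l2%:E <= lconj G p by rewrite Gl.
move=> /lconj_geP/(_ v)/le_trans/(_ Gv); rewrite lee_fin => h2.
rewrite -(subrK w x) xu wv dotDl !dotZl.
apply: le_trans (lerD (ler_wpM2l t0 h1) (ler_wpM2l t1' h2)).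
by rewrite le_eqVlt; apply/orP; left; apply/eqP; ring.
Qed.

Lemma quad_sub (R : realType) (n : nat) (mu : R) (u w : 'rV[R]_n) :
  mu != 0%R -> (quad mu (u - w) = quad mu u - dot u (mu^-1 *: w) + quad mu w)%R.
Proof.
move=> mu0; rewrite !quadE dotBl !dotBr dotZr (dotC w u); field.
exact: mu0.
Qed.

Lemma moreauE (R : realType) (n : nat) (mu : R) (h : 'rV[R]_n -> \bar R) w :
  mu != 0%R ->
  moreau mu h w = lconj (add_quad mu h) (mu^-1 *: w)%R + (quad mu w)%:E.
Proof.
move=> mu0; rewrite /moreau /lconj -ereal_inf_addr; congr ereal_inf.
by apply: eq_imagel => u _; rewrite /add_quad quad_sub // !EFinD EFinN !addeA.
Qed.

(** This class is stable under [conv_fun] and the weighted [infconv] with the same [c] and [a]; the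
    unchanged [a] is what the threshold of the average rests on. *)
Definition coercive_lsc (R : realType) (n : nat) (c a : R)
    (h : 'rV[R]_n -> \bar R) : Prop :=
  [/\ (0 < a)%R, quad_minorized c a h, lower_semicontinuous h & proper_fun h].

Lemma coercive_lsc_conv_fun (R : realType) (n : nat) (c a : R)
    (h : 'rV[R]_n -> \bar R) :
  coercive_lsc c a h -> coercive_lsc c a (conv_fun h).
Proof.
move=> [a0 hq hl hp].
have cq : quad_minorized c a (conv_fun h).
  by apply: conv_fun_quad_minorized => //; exact: ltW.
split => //; first exact: conv_fun_lsc hq hp hl.
exact: quad_minorized_proper cq (@conv_fun_le _ _ h) hp.
Qed.

Lemma coercive_lsc_infconv (R : realType) (n : nat) (c a t : R)
    (F G : 'rV[R]_n -> \bar R) :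
  coercive_lsc c a F -> coercive_lsc c a G -> (0 <= t <= 1)%R ->
  coercive_lsc c a (infconv (epi_scale t F) (epi_scale (1 - t)%R G)).
Proof.
move=> [a0 Fq Fl Fp] [_ Gq Gl Gp] t01.
have iq : quad_minorized c a (infconv (epi_scale t F) (epi_scale (1 - t)%R G)).
  exact: (infconv_ge_convex Fp Gp (@quad_convex R n c a (ltW a0)) Fq Gq t01).
split => //; first exact: infconv_lsc Fq Gq Fl Gl t01.
split; first exact: quad_minorized_gtNy iq.
case: Fp Gp => [_ [u]] + [_ [v]]; rewrite /dom /= => Fu Gv.
have [p Fp] := lty_le_fin Fu; have [q Gq'] := lty_le_fin Gv.
exists (t *: u + (1 - t) *: v)%R.
exact: le_lt_trans (infconv_le t01 Fp Gq') (ltry _).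
Qed.

Lemma quad_continuous (R : realType) (n : nat) (mu : R) :
  continuous (@quad R n mu).
Proof.
have -> : @quad R n mu = (fun x => (2 * mu)^-1 * dot (x - 0) (x - 0))%R.
  by apply/funext => x; rewrite quadE subr0.
exact: sqdist_continuous.
Qed.

Lemma add_quad_proper (R : realType) (n : nat) (mu : R) (h : 'rV[R]_n -> \bar R) :
  proper_fun h -> proper_fun (add_quad mu h).
Proof.
move=> [hN [u hu]]; split.
  move=> x; rewrite /add_quad; have := hN x; case: (h x) => // r _.
  by rewrite -EFinD ltNyr.
by exists u; rewrite /dom /add_quad /= lte_add_pinfty // ltry.
Qed.

Lemma add_quad_lsc (R : realType) (n : nat) (mu : R) (h : 'rV[R]_n -> \bar R) :
  (forall x, -oo < h x) -> lower_semicontinuous h ->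
  lower_semicontinuous (add_quad mu h).
Proof.
move=> hN hl; apply: lsc_add => //; first by move=> x; rewrite ltNyr.
by apply: lsc_EFin; exact: quad_continuous.
Qed.

Lemma dom_add_quad (R : realType) (n : nat) (mu : R) (h : 'rV[R]_n -> \bar R) :
  dom (add_quad mu h) = dom h.
Proof.
by apply/seteqP; split=> x; rewrite /dom /add_quad /=;
  case: (h x) => [r| |] // _; rewrite -?EFinD ?ltry.
Qed.

Lemma prox_parameters_of_minorized (R : realType) (n : nat) (lambda c : R)
    (h : 'rV[R]_n -> \bar R) :
  (0 < lambda)%R -> (forall u, (c - quad lambda u)%:E <= h u) ->
  prox_parameters h lambda.
Proof.
move=> l0 hc; split => //; exists 0%R.
apply: (@lt_le_trans _ _ c%:E); first by rewrite ltNyr.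
apply: le_ereal_inf_tmp => _ [u _ <-]; rewrite subr0.
by rewrite -leeBlDr // -EFinB.
Qed.

(** A finite envelope bounds [h] below by a quadratic centred at some x0 with a parameter k >
    lambda; the gap between the two curvatures pays for recentring at 0. *)
Lemma prox_threshold_minorized (R : realType) (n : nat) (lambda : R)
    (h : 'rV[R]_n -> \bar R) :
  (0 < lambda)%R -> lambda%:E < prox_threshold h ->
  exists c, forall u, (c - quad lambda u)%:E <= h u.
Proof.
move=> l0 /ereal_sup_gt[_ [k [k0 [x0 hx0]] <-]]; rewrite lte_fin => lk.
have [r hr] : exists r : R, r%:E <= moreau k h x0.
  case: (moreau k h x0) hx0 => // [r _|_]; first by exists r.
  by exists 0%R; exact: leey.
pose A := ((2 * k)^-1)%R; pose B := ((2 * lambda)^-1)%R.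
have AB : (0 < B - A)%R.
  by rewrite subr_gt0 /A /B ltf_pV2 ?posrE ?mulr_gt0 // ltr_pM2l.
(* Obtained by completing the square in (B - A) |u|^2 + 2 A <u, x0>. *)
exists (r - (A ^+ 2 / (B - A) + A) * dot x0 x0)%R => u.
have : r%:E <= h u + (quad k (u - x0)%R)%:E.
  by apply: le_trans hr _; apply: ereal_inf_lbound; exists u.
rewrite -leeBlDr // -EFinB; apply: le_trans; rewrite lee_fin !quadE -/A -/B.
have := dot_ge0 (u + (A / (B - A)) *: x0)%R.
rewrite -(pmulr_rge0 _ AB) !(dotDl, dotDr, dotZl, dotZr, dotNl, dotNr) (dotC x0 u).
have -> : ((B - A) * (dot u u + A / (B - A) * dot u x0 +
    (A / (B - A) * dot u x0 + A / (B - A) * (A / (B - A) * dot x0 x0))) =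
    (B - A) * dot u u + 2 * A * dot u x0 + A ^+ 2 / (B - A) * dot x0 x0)%R.
  by field; rewrite gt_eqF.
set C := (A ^+ 2 / (B - A))%R; lra.
Qed.

Lemma coercive_lsc_add_quad (R : realType) (n : nat) (mu lambda : R)
    (h : 'rV[R]_n -> \bar R) :
  (0 < mu)%R -> (mu < lambda)%R -> lambda%:E < prox_threshold h ->
  proper_fun h -> lower_semicontinuous h ->
  exists c0, forall c, (c <= c0)%R ->
    coercive_lsc c ((2 * mu)^-1 - (2 * lambda)^-1)%R (add_quad mu h).
Proof.
move=> mu0 ml lt hp hl; have l0 := lt_trans mu0 ml.
have [c0 hc] := prox_threshold_minorized l0 lt.
exists c0 => c cc0; split.
- by rewrite subr_gt0 ltf_pV2 ?posrE ?mulr_gt0 // ltr_pM2l.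
- move=> u; rewrite /add_quad -leeBlDr // -EFinB.
  apply: le_trans (hc u); rewrite lee_fin !quadE; lra.
- by apply: add_quad_lsc => //; case: hp.
- exact: add_quad_proper.
Qed.

Lemma conv_fun_id (R : realType) (n : nat) (h : 'rV[R]_n -> \bar R) :
  convex_fun h -> conv_fun h = h.
Proof.
move=> ch; apply/funext => x; apply/eqP; rewrite eq_le conv_fun_le /=.
exact: conv_fun_max.
Qed.

Lemma infconv_scale1 (R : realType) (n : nat) (F G : 'rV[R]_n -> \bar R) x :
  (forall x, -oo < F x) ->
  infconv (epi_scale 1 F) (epi_scale (1 - 1)%R G) x = F x.
Proof.
move=> FN.
have E w : epi_scale 1 F (x - w)%R + epi_scale (1 - 1)%R G w =
    F (x - w)%R + (if w == 0%R then 0 else +oo).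
  by rewrite /epi_scale subrr eqxx oner_eq0 invr1 scale1r mul1e.
apply/eqP; rewrite eq_le; apply/andP; split.
  by apply: ge_ereal_inf; exists (F x) => //; exists 0%R; rewrite // E eqxx subr0 adde0.
apply: le_ereal_inf_tmp => _ [w _ <-]; rewrite E; case: eqP => [->|_].
  by rewrite subr0 adde0.
by rewrite addey ?leey // gt_eqF.
Qed.

Lemma moreau_fin_num (R : realType) (n : nat) (mu c a : R)
    (h : 'rV[R]_n -> \bar R) w :
  (0 < mu)%R -> coercive_lsc c a (add_quad mu h) -> moreau mu h w \is a fin_num.
Proof.
move=> mu0 [a0 hq _ hp]; rewrite moreauE ?gt_eqF // fin_numD andbT.
exact: lconj_fin_num hq hp.
Qed.

(** The inequality <= is Fenchel's inequality; for >=, each real r below the right-hand side is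
    realized through an affine minorant of [Phi]. *)
Lemma prox_averageE (R : realType) (n : nat) (mu alpha c a : R)
    (f g : 'rV[R]_n -> \bar R) x :
  (0 < mu)%R -> (0 <= alpha <= 1)%R ->
  coercive_lsc c a (add_quad mu f) -> coercive_lsc c a (add_quad mu g) ->
  prox_average mu alpha f g x =
  infconv (epi_scale alpha (conv_fun (add_quad mu f)))
          (epi_scale (1 - alpha)%R (conv_fun (add_quad mu g))) x
    - (quad mu x)%:E.
Proof.
move=> mu0 al fc gc.
have Fc := coercive_lsc_conv_fun fc; have Gc := coercive_lsc_conv_fun gc.
have [a0 Pq Pl Pp] := coercive_lsc_infconv Fc Gc al.
set Phi := infconv _ _ in Pq Pl Pp *.
have Pc : convex_fun Phi.
  case: Fc Gc => [_ Fq Fl Fp] [_ Gq Gl Gp].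
  exact: (infconv_convex a0 Fq Gq Fl Gl Fp Gp (@conv_fun_convex _ _ _)
           (@conv_fun_convex _ _ _) al).
have inner y : - (alpha%:E * moreau mu f y) - (1 - alpha)%:E * moreau mu g y =
    - (lconj Phi (mu^-1 *: y)%R + (quad mu y)%:E).
  rewrite !moreauE ?gt_eqF //.
  rewrite -(lconj_conv_fun (add_quad mu f)) -(lconj_conv_fun (add_quad mu g)).
  case: Fc Gc => [_ Fq _ Fp] [_ Gq _ Gp].
  have := lconj_fin_num (mu^-1 *: y)%R a0 Fq Fp.
  have := lconj_fin_num (mu^-1 *: y)%R a0 Gq Gp.
  case El : (lconj (conv_fun (add_quad mu f)) _) => [l1| |] //.
  case Er : (lconj (conv_fun (add_quad mu g)) _) => [l2| |] // _ _.
  rewrite (lconj_infconv Fp Gp al El Er) -!(EFinN, EFinM, EFinD).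
  by congr EFin; ring.
have innerfin y : exists l : R, lconj Phi y = l%:E.
  by have := lconj_fin_num y a0 Pq Pp; case: (lconj Phi y) => // l _; exists l.
rewrite /prox_average; apply/eqP; rewrite eq_le; apply/andP; split.
  rewrite leeNl; apply: le_ereal_inf_tmp => _ [y _ <-]; rewrite inner.
  have [l lE] := innerfin (mu^-1 *: y)%R; rewrite lE quad_sub ?gt_eqF //.
  have : l%:E <= lconj Phi (mu^-1 *: y)%R by rewrite lE.
  move=> /lconj_geP/(_ x); case: (Phi x) => [s| |] //.
    rewrite -!(EFinN, EFinD) !lee_fin !dotZr (dotC y); lra.
  by rewrite addye // leNye.
apply: lee_of_fin_le => r; rewrite lteBrDr // -EFinD.
move=> /(affine_minorant a0 Pq Pl Pp Pc)[p pP].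
have [l lE] := innerfin p.
have : (r + quad mu x - dot x p)%:E <= lconj Phi p.
  by apply/lconj_geP => u; apply: le_trans (pP u); rewrite lee_fin dotBl; lra.
rewrite lE lee_fin leeNr => rl; apply: ge_ereal_inf.
(* Tested at y = mu p, where the conjugate is evaluated at the slope [p] of the minorant. *)
exists (- (l + quad mu (mu *: p)) + quad mu (mu *: p - x)%R)%:E.
  exists (mu *: p)%R => //; rewrite inner scalerA mulVf ?gt_eqF // scale1r lE.
  by rewrite -EFinD.
rewrite -EFinN lee_fin quad_sub ?gt_eqF // dotZl dotZr mulrA divff ?gt_eqF //.
by rewrite (dotC p); lra.
Qed.

(** * Proximal averages *)

Lemma add_quad_prox_average (R : realType) (n : nat) (mu alpha c a : R)
    (f g : 'rV[R]_n -> \bar R) :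
  (0 < mu)%R -> (0 <= alpha <= 1)%R ->
  coercive_lsc c a (add_quad mu f) -> coercive_lsc c a (add_quad mu g) ->
  add_quad mu (prox_average mu alpha f g) =
  infconv (epi_scale alpha (conv_fun (add_quad mu f)))
          (epi_scale (1 - alpha)%R (conv_fun (add_quad mu g))).
Proof.
move=> mu0 al fc gc; apply/funext => x.
by rewrite /add_quad (prox_averageE _ mu0 al fc gc) subeK.
Qed.

Lemma moreau_prox_average (R : realType) (n : nat) (mu alpha c a : R)
    (f g : 'rV[R]_n -> \bar R) w :
  (0 < mu)%R -> (0 <= alpha <= 1)%R ->
  coercive_lsc c a (add_quad mu f) -> coercive_lsc c a (add_quad mu g) ->
  moreau mu (prox_average mu alpha f g) w =
  alpha%:E * moreau mu f w + (1 - alpha)%:E * moreau mu g w.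
Proof.
move=> mu0 al fc gc; rewrite !moreauE ?gt_eqF //.
rewrite (add_quad_prox_average mu0 al fc gc).
rewrite -(lconj_conv_fun (add_quad mu f)) -(lconj_conv_fun (add_quad mu g)).
have [a0 Fq _ Fp] := coercive_lsc_conv_fun fc.
have [_ Gq _ Gp] := coercive_lsc_conv_fun gc.
have := lconj_fin_num (mu^-1 *: w)%R a0 Fq Fp.
have := lconj_fin_num (mu^-1 *: w)%R a0 Gq Gp.
case El : (lconj (conv_fun (add_quad mu f)) _) => [l1| |] //.
case Er : (lconj (conv_fun (add_quad mu g)) _) => [l2| |] // _ _.
rewrite (lconj_infconv Fp Gp al El Er) -!(EFinM, EFinD).
by congr EFin; ring.
Qed.

Lemma prox_average1 (R : realType) (n : nat) (mu : R)
    (f g : 'rV[R]_n -> \bar R) :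
  prox_average mu 1 f g = prox_hull mu f.
Proof.
apply/funext => x; rewrite prox_hullE /prox_average; congr (- moreau _ _ _).
by apply/funext => y; rewrite mul1e subrr mul0e sube0.
Qed.

Lemma prox_average0 (R : realType) (n : nat) (mu : R)
    (f g : 'rV[R]_n -> \bar R) :
  prox_average mu 0 f g = prox_hull mu g.
Proof.
apply/funext => x; rewrite prox_hullE /prox_average; congr (- moreau _ _ _).
by apply/funext => y; rewrite mul0e subr0 mul1e oppe0 add0e.
Qed.

(** The envelope formula at weight 1. As [prox_average] sees its arguments only through their
    envelopes, this is the content of (e). *)
Lemma moreau_prox_hull (R : realType) (n : nat) (mu c a : R)
    (f : 'rV[R]_n -> \bar R) :
  (0 < mu)%R -> coercive_lsc c a (add_quad mu f) ->
  moreau mu (prox_hull mu f) = moreau mu f.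
Proof.
move=> mu0 fc; apply/funext => w; rewrite -(prox_average1 mu f f).
rewrite (moreau_prox_average _ mu0 _ fc fc) ?lexx ?ler01 //.
by rewrite mul1e subrr mul0e adde0.
Qed.

Lemma prox_average_self (R : realType) (n : nat) (mu alpha c a : R)
    (f : 'rV[R]_n -> \bar R) :
  (0 < mu)%R -> coercive_lsc c a (add_quad mu f) ->
  prox_average mu alpha f f = prox_hull mu f.
Proof.
move=> mu0 fc; apply/funext => x; rewrite prox_hullE /prox_average.
congr (- moreau _ _ _); apply/funext => y.
have := moreau_fin_num y mu0 fc; case: (moreau mu f y) => [r| |] // _.
by rewrite -!(EFinN, EFinM, EFinD); congr EFin; ring.
Qed.

Lemma prox_hull_proximal (R : realType) (n : nat) (mu c a : R)
    (f : 'rV[R]_n -> \bar R) :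
  (0 < mu)%R -> coercive_lsc c a (add_quad mu f) -> mu_proximal mu f ->
  prox_hull mu f = f.
Proof.
move=> mu0 fc fm; apply/funext => x; rewrite -(prox_average1 mu f f).
rewrite (prox_averageE _ mu0 _ fc fc) ?lexx ?ler01 //.
rewrite conv_fun_id // infconv_scale1 ?addeK //.
by case: fc => [_ fq _ _]; exact: quad_minorized_gtNy fq.
Qed.

(** * Effective domains *)

Lemma convex_set_smallest (R : realType) (V : lmodType R) (A : set V) :
  @convex_set R V (conv_set A).
Proof.
move=> x y t; rewrite !inE => xA yA M [cM AM].
have := cM x y t; rewrite !inE; apply; [exact: xA|exact: yA].
Qed.

Lemma convex_dom (R : realType) (n : nat) (k : 'rV[R]_n -> \bar R) :
  convex_fun k -> @convex_set R 'rV[R]_n (dom k).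
Proof.
move=> ck x y t; rewrite !inE /dom /= => kx ky.
have [p kp] := lty_le_fin kx; have [q kq] := lty_le_fin ky.
move/convex_funP : ck => /(_ x y p q t%:num) ck.
by apply: le_lt_trans (ck _ kp kq) (ltry _); rewrite ge0 le1.
Qed.

Lemma dom_conv_fun (R : realType) (n : nat) (c : R) (h : 'rV[R]_n -> \bar R) :
  (forall x, c%:E <= h x) -> dom (conv_fun h) = conv_set (dom h).
Proof.
move=> hc; apply/seteqP; split=> x; last first.
  apply: smallest_sub; first exact: convex_dom (@conv_fun_convex _ _ h).
  by move=> y; apply: le_lt_trans; exact: conv_fun_le.
(* c on the convex hull of dom h and +oo elsewhere is a convex minorant. *)
pose k y := if y \in conv_set (dom h) then c%:E else +oo.
have kc : convex_fun k.
  apply/convex_funP => y z p q t t01; rewrite /k.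
  case: ifPn => // yC; case: ifPn => // zC cp cq.
  have /andP[t0 t1] := t01.
  have := convex_set_smallest (Itv01 t0 t1) yC zC; rewrite /conv /= => ->.
  move: cp cq; rewrite !lee_fin => cp cq.
  have := lerD (ler_wpM2l t0 cp) (ler_wpM2l (_ : 0 <= 1 - t)%R cq).
  rewrite subr_ge0 => /(_ t1); lra.
have kh y : k y <= h y.
  rewrite /k; case: ifPn => // yC; rewrite leNgt.
  by apply: contra yC => yh; rewrite inE; exact: sub_gen_smallest.
rewrite /dom /= => /(le_lt_trans (conv_fun_max kc kh x)); rewrite /k.
by case: ifPn => [|_]; rewrite ?ltxx // inE.
Qed.

Lemma dom_infconv (R : realType) (n : nat) (t : R) (F G : 'rV[R]_n -> \bar R) :
  proper_fun F -> proper_fun G -> (0 <= t <= 1)%R ->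
  dom (infconv (epi_scale t F) (epi_scale (1 - t)%R G)) =
  set_add (set_scale t (dom F)) (set_scale (1 - t)%R (dom G)).
Proof.
move=> Fp Gp t01; apply/seteqP; split=> [x|].
  move=> /ereal_inf_lt[_ [w _ <-]].
  move=> /(epi_scale_add_ltyP Fp Gp t01)[u [v [p [q [Fu Gv xu wv _]]]]].
  exists (t *: u)%R; first by exists u => //; exact: le_lt_trans Fu (ltry _).
  exists ((1 - t) *: v)%R; first by exists v => //; exact: le_lt_trans Gv (ltry _).
  by rewrite -xu -wv subrK.
move=> _ [_ [u Fu <-] [_ [v Gv <-] <-]]; move: Fu Gv; rewrite /dom /= => Fu Gv.
have [p Fp'] := lty_le_fin Fu; have [q Gq] := lty_le_fin Gv.
exact: le_lt_trans (infconv_le t01 Fp' Gq) (ltry _).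
Qed.

Lemma conv_set_nonempty (R : realType) (V : lmodType R) (A : set V) :
  A !=set0 -> conv_set A !=set0.
Proof.
move=> [x Ax]; exists x; exact: sub_gen_smallest.
Qed.

Lemma set_add_scale_setT (R : realType) (V : lmodType R) (a b : R) (A B : set V) :
  (a != 0)%R -> A = setT -> B !=set0 ->
  set_add (set_scale a A) (set_scale b B) = setT.
Proof.
move=> a0 -> [y By]; apply/seteqP; split=> // x _.
exists (a *: (a^-1 *: (x - b *: y)))%R; first by exists (a^-1 *: (x - b *: y))%R.
exists (b *: y)%R; first by exists y.
by rewrite scalerA divff // scale1r subrK.
Qed.

Lemma set_addC (R : realType) (V : lmodType R) (A B : set V) :
  set_add A B = set_add B A.
Proof.
by apply/seteqP; split=> _ [x Ax [y By <-]]; exists y => //; exists x => //;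
  rewrite addrC.
Qed.

Lemma mu_proximalE (R : realType) (n : nat) (mu : R) (h : 'rV[R]_n -> \bar R) :
  (forall x, -oo < h x) -> mu_proximal mu h <-> mu_hypoconvex mu h.
Proof.
move=> hN; split=> [/convex_funP hp x y t /andP[t0 t1]|hh].
  have t1' : (0 < 1 - t)%R by rewrite subr_gt0.
  have RN (s : R) z : (0 < s)%R -> s%:E * h z != -oo.
    move=> s0; have := hN z; case: (h z) => [r| |] // _.
    by rewrite gt0_muley ?lte_fin.
  case hx : (h x) (hN x) => [p| |] // _; last first.
    by rewrite gt0_muley ?lte_fin // !addye ?leey // RN.
  case hy : (h y) (hN y) => [q| |] // _; last first.
    by rewrite gt0_muley ?lte_fin // addey // addye ?leey.
  have t01 : (0 <= 1 - t <= 1)%R by rewrite gerBl (ltW t0) (ltW t1').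
  have hx' : add_quad mu h x <= (p + quad mu x)%:E by rewrite /add_quad hx.
  have hy' : add_quad mu h y <= (q + quad mu y)%:E by rewrite /add_quad hy.
  have := hp x y _ _ _ t01 hx' hy'; rewrite /add_quad.
  rewrite subKr -leeBrDr // => /le_trans; apply.
  rewrite -!(EFinN, EFinM, EFinD) lee_fin !quadE enorm_sqr.
  have := congr1 ( *%R (2 * mu)^-1) (dot_convex (1 - t)%R x y).
  by rewrite subKr; set A := (_^-1)%R; lra.
(* Hypoconvexity speaks of 0 < t < 1 only, so the endpoints are treated apart. *)
apply/convex_funP => x y p q t /andP[]; rewrite le_eqVlt => /orP[/eqP<-|t0].
  by rewrite scale0r add0r subr0 scale1r mul0r add0r mul1r.
rewrite le_eqVlt => /orP[/eqP->|t1].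
  by rewrite subrr scale0r addr0 scale1r mul0r addr0 mul1r.
have t1' : (0 < 1 - t)%R by rewrite subr_gt0.
rewrite /add_quad -!leeBrDr // -!EFinB => hx hy.
have := hh x y (1 - t)%R; rewrite t1' gtrBl t0 subKr => /(_ isT) hxy.
apply: le_trans hxy _.
apply: (@le_trans _ _ (t%:E * (p - quad mu x)%:E + (1 - t)%:E * (q - quad mu y)%:E
  + ((2 * mu)^-1 * (1 - t) * t * enorm (x - y) ^+ 2)%:E)).
  by rewrite leeD2r //; apply: leeD; rewrite lee_pmul2l ?lte_fin.
rewrite -!(EFinM, EFinD) lee_fin !quadE enorm_sqr.
have := congr1 ( *%R (2 * mu)^-1) (dot_convex t x y).
by set A := (_^-1)%R; lra.
Qed.

Lemma quadN (R : realType) (n : nat) (mu : R) (x : 'rV[R]_n) :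
  quad mu (- x)%R = quad mu x.
Proof. by rewrite !quadE dotNl dotNr opprK. Qed.

Lemma oppe_moreau (R : realType) (n : nat) (mu : R)
    (k : 'rV[R]_n -> \bar R) x :
  - moreau mu k x =
  ereal_sup [set - k w - (quad mu (x - w)%R)%:E | w in [set: 'rV[R]_n]].
Proof.
rewrite /moreau /ereal_inf oppeK image_comp; congr ereal_sup.
apply: eq_imagel => w _ /=.
by rewrite oppeD ?fin_num_adde_defl // -(opprB w x) quadN.
Qed.

(* mu = 0 is allowed: then quad mu vanishes, since 0^-1 = 0. *)
Lemma moreau_cst (R : realType) (n : nat) (mu c : R)
    (h : 'rV[R]_n -> \bar R) x :
  (0 <= mu)%R -> (forall u, h u = c%:E) -> moreau mu h x = c%:E.
Proof.
move=> mu0 hc; apply/eqP; rewrite eq_le; apply/andP; split.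
  apply: ge_ereal_inf; exists (h x + (quad mu (x - x)%R)%:E); first by exists x.
  by rewrite hc subrr quadE dot0l mulr0 adde0.
apply: le_ereal_inf_tmp => _ [u _ <-]; rewrite hc -EFinD lee_fin lerDl quadE.
by rewrite mulr_ge0 ?dot_ge0 // invr_ge0 mulr_ge0.
Qed.

(** The parameter mu/alpha multiplies the quadratic by alpha, which then factors out of the
    infimum. *)
Lemma moreau_scale (R : realType) (n : nat) (mu alpha b : R)
    (h : 'rV[R]_n -> \bar R) w :
  (0 < mu)%R -> (0 < alpha)%R ->
  moreau (mu / alpha)%R (fun y => alpha%:E * h y + b%:E) w =
  alpha%:E * moreau mu h w + b%:E.
Proof.
move=> mu0 al0; rewrite /moreau -ereal_inf_pZl // image_comp -ereal_inf_addr.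
congr ereal_inf; apply: eq_imagel => u _ /=.
rewrite muleDr ?fin_num_adde_defl // addeAC; congr (_ + _ + _).
by rewrite -EFinM !quadE; congr EFin; field; rewrite !gt_eqF.
Qed.

Lemma prox_average_cst (R : realType) (n : nat) (mu alpha c a b : R)
    (f g : 'rV[R]_n -> \bar R) x :
  (0 < mu)%R -> (0 <= alpha)%R -> coercive_lsc c a (add_quad mu f) ->
  (forall y, g y = b%:E) ->
  prox_average mu alpha f g x =
  lasry_lions (mu / alpha)%R mu
    (fun y => alpha%:E * f y + ((1 - alpha) * b)%:E) x.
Proof.
move=> mu0 al0 fc gb; rewrite /prox_average oppe_moreau /lasry_lions.
congr ereal_sup; apply: eq_imagel => w _; congr (_ - _).
rewrite (moreau_cst _ (ltW mu0) gb).
move: al0; rewrite le_eqVlt => /orP[/eqP<-|al0].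
  (* At alpha = 0 the parameter mu / 0 is 0 and the quadratic vanishes; the function is the constant
     [b], and so is its envelope. *)
  rewrite [RHS](moreau_cst (c := b)) ?invr0 ?mulr0 //.
    by rewrite mul0e oppe0 add0e subr0 mul1e oppeK.
  by move=> u; rewrite mul0e add0e subr0 mul1r.
rewrite moreau_scale //; have := moreau_fin_num w mu0 fc.
case: (moreau mu f w) => [r| |] // _.
by rewrite -!(EFinM, EFinD, EFinN); congr EFin; ring.
Qed.

(** In (d) the whole-space claim requires a nonzero weight on the set that is the whole space, since
    scaling by 0 collapses it to {0}. *)
Theorem theorem5p1 (R : realType) (n : nat) (f g : 'rV[R]_n -> \bar R)
    (mu alpha : R)
    (f_proper : proper_fun f) (f_lsc : lower_semicontinuous f)
    (f_pb : prox_bounded f)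
    (g_proper : proper_fun g) (g_lsc : lower_semicontinuous g)
    (g_pb : prox_bounded g)
    (mu_gt0 : (0 < mu)%R)
    (mu_lt : mu%:E < Order.min (prox_threshold f) (prox_threshold g))
    (alpha01 : (0 <= alpha <= 1)%R) :
  let phi := prox_average mu alpha f g in
  let F := conv_fun (add_quad mu f) in
  let G := conv_fun (add_quad mu g) in
  (* (a) *)
  (forall x, moreau mu phi x =
     alpha%:E * moreau mu f x + (1 - alpha)%:E * moreau mu g x) /\
  (* (b) *)
  (proper_fun phi /\ lower_semicontinuous phi /\ prox_bounded phi /\
     Order.min (prox_threshold f) (prox_threshold g) <= prox_threshold phi) /\
  (* (c) *)
  ((forall x, phi x =
      infconv (epi_scale alpha F) (epi_scale (1 - alpha) G) x
        - (quad mu x)%:E) /\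
   infconv_exact (epi_scale alpha F) (epi_scale (1 - alpha) G) /\
   epi (add_quad mu phi) =
     set_add (set_scale alpha (epi F)) (set_scale (1 - alpha) (epi G))) /\
  (* (d) *)
  (dom phi = set_add (set_scale alpha (conv_set (dom f)))
                     (set_scale (1 - alpha) (conv_set (dom g))) /\
   ((alpha != 0%R /\ conv_set (dom f) = [set: 'rV[R]_n]) \/
    (alpha != 1%R /\ conv_set (dom g) = [set: 'rV[R]_n]) ->
    dom phi = [set: 'rV[R]_n])) /\
  (* (e) *)
  (forall x, phi x = prox_average mu alpha (prox_hull mu f) (prox_hull mu g) x)
  /\
  (* (f) *)
  ((alpha = 0%R -> forall x, phi x = prox_hull mu g x) /\
   (alpha = 1%R -> forall x, phi x = prox_hull mu f x)) /\
  (* (g) *)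
  (mu_proximal mu phi /\ mu_hypoconvex mu phi /\
   forall h : 'rV[R]_n -> \bar R, proper_fun h ->
     (mu_proximal mu h <-> mu_hypoconvex mu h)) /\
  (* (h) *)
  (f = g -> (forall x, phi x = prox_hull mu f x) /\
            (mu_proximal mu f -> forall x, phi x = f x)) /\
  (* (i) *)
  (forall c : R, (forall x, g x = c%:E) ->
     forall x, phi x =
       lasry_lions (mu / alpha)%R mu
         (fun y => alpha%:E * f y + ((1 - alpha) * c)%:E) x).
Proof.
have [_ [u0 fu0]] := f_proper; have [_ [v0 gv0]] := g_proper.
have al' : (0 <= 1 - alpha <= 1)%R.
  by case/andP: alpha01 => al0 al1; rewrite subr_ge0 al1 gerBl.
pose a lam := ((2 * mu)^-1 - (2 * lam)^-1 : R)%R.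
(* Kept general in [lam]: one value serves most claims, but the threshold in (b) needs all of
   them. *)
have common lam : (mu < lam)%R ->
    lam%:E < Order.min (prox_threshold f) (prox_threshold g) ->
    exists c, coercive_lsc c (a lam) (add_quad mu f) /\
              coercive_lsc c (a lam) (add_quad mu g).
  move=> ml; rewrite lt_min => /andP[lf lg].
  have [cf hf] := coercive_lsc_add_quad mu_gt0 ml lf f_proper f_lsc.
  have [cg hg] := coercive_lsc_add_quad mu_gt0 ml lg g_proper g_lsc.
  by exists (Num.min cf cg); split; [apply: hf|apply: hg];
    rewrite ge_min lexx ?orbT.
have [lam0 ml0 l0lt] := lte_fin_between mu_lt.
have [c [fc gc]] := common _ ml0 l0lt.
have Fc := coercive_lsc_conv_fun fc; have Gc := coercive_lsc_conv_fun gc.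
have [a0 Fq Fl Fp] := Fc; have [_ Gq Gl Gp] := Gc.
move=> phi F G.
have [_ Pq Pl Pp] := coercive_lsc_infconv Fc Gc alpha01.
have phiE : add_quad mu phi = infconv (epi_scale alpha F) (epi_scale (1 - alpha) G).
  exact: add_quad_prox_average mu_gt0 alpha01 fc gc.
have phi_pt x : phi x = infconv (epi_scale alpha F) (epi_scale (1 - alpha) G) x
        - (quad mu x)%:E.
  exact: prox_averageE _ mu_gt0 alpha01 fc gc.
have epiE := epi_infconv a0 Fq Gq Fl Gl Fp Gp alpha01.
have phi_conv : mu_proximal mu phi.
  rewrite /mu_proximal phiE.
  exact: (infconv_convex a0 Fq Gq Fl Gl Fp Gp (@conv_fun_convex _ _ _)
           (@conv_fun_convex _ _ _) alpha01).
have phi_proper : proper_fun phi.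
  split.
    move=> x; rewrite phi_pt; have := Pp.1 x.
    by case: (infconv _ _ x) => // r _; rewrite -EFinB ltNyr.
  by rewrite -(dom_add_quad mu) phiE; case: Pp.
have phi_params lam : (mu < lam)%R ->
    lam%:E < Order.min (prox_threshold f) (prox_threshold g) ->
    prox_parameters phi lam.
  move=> ml llt; have [c' [fc' gc']] := common _ ml llt.
  have [_ q _ _] := coercive_lsc_infconv (coercive_lsc_conv_fun fc')
    (coercive_lsc_conv_fun gc') alpha01.
  apply: (@prox_parameters_of_minorized _ _ _ c').
    exact: lt_trans mu_gt0 ml.
  move=> u; rewrite phi_pt leeBrDr // -EFinD; apply: le_trans (q u).
  by rewrite lee_fin !quadE /a; lra.
have domE (h : 'rV[R]_n -> \bar R) : coercive_lsc c (a lam0) (add_quad mu h) ->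
    dom (conv_fun (add_quad mu h)) = conv_set (dom h).
  move=> [_ hq _ _]; rewrite (@dom_conv_fun _ _ c) ?dom_add_quad // => x.
  by apply: le_trans (hq x); rewrite lee_fin lerDl mulr_ge0 ?dot_ge0 // ltW.
have phi_dom : dom phi = set_add (set_scale alpha (conv_set (dom f)))
                           (set_scale (1 - alpha) (conv_set (dom g))).
  by rewrite -(dom_add_quad mu) phiE dom_infconv // !domE.
split; first by move=> x; exact: moreau_prox_average mu_gt0 alpha01 fc gc.
split.
  split => //; split.
    have -> : phi = (fun x => infconv (epi_scale alpha F)
        (epi_scale (1 - alpha) G) x + (- quad mu x)%:E).
      by apply/funext => x; rewrite phi_pt.
    apply: lsc_add => //; [by case: Pp|by move=> x; rewrite ltNyr|].
    by apply: lsc_EFin => x; exact: cvgN (@quad_continuous R n mu x).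
  split; first by exists lam0; exact: phi_params.
  (* [phi_params] concerns parameters above mu only; a level r <= mu lies below [lam0]. *)
  apply: lee_of_fin_le => r rlt; have [rm|mr] := leP r mu.
    apply: (@le_trans _ _ lam0%:E); first by rewrite lee_fin (le_trans rm) ?ltW.
    by apply: ereal_sup_ubound; exists lam0 => //; exact: phi_params.
  by apply: ereal_sup_ubound; exists r => //; exact: phi_params.
split.
  split => //; split; last by rewrite phiE.
  exact: infconv_attained a0 Fq Gq Fl Gl alpha01.
split.
  split => // -[[al fT]|[al gT]]; rewrite phi_dom.
    by apply: set_add_scale_setT => //; apply: conv_set_nonempty; exists v0.
  rewrite set_addC; apply: set_add_scale_setT => //.
    by rewrite subr_eq0 eq_sym.
  by apply: conv_set_nonempty; exists u0.
split.
  move=> x; rewrite /phi /prox_average (moreau_prox_hull mu_gt0 fc).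
  by rewrite (moreau_prox_hull mu_gt0 gc).
split.
  by split=> al x; rewrite /phi al ?prox_average0 ?prox_average1.
split.
  split => //; split; first by apply/mu_proximalE => //; case: phi_proper.
  by move=> h [hN _]; exact: mu_proximalE.
split.
  move=> fg; have phi_hull : phi = prox_hull mu f.
    by rewrite /phi -fg (prox_average_self _ mu_gt0 fc).
  split=> [x|fm x]; rewrite phi_hull //.
  by rewrite (prox_hull_proximal mu_gt0 fc).
move=> b gb x; apply: prox_average_cst fc gb => //.
by case/andP: alpha01.
Qed.
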